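(* There exist a Banach space $X$ with separable dual $X^*$, a closed, bounded, convex, symmetric subset $W$ of $X$, and a closed subspace $Y$ of $X^*$ such that: (1) $W$ is a thin subset of $X$; (2) $c_0(\mathbb{N})^*$ is isometric and $w^*$-isomorphic to $Y$, i.e. there is a linear isometry of $c_0(\mathbb{N})^*$ onto $Y$ which is a homeomorphism between the topology $\sigma(c_0^*,c_0)$ and the topology induced on $Y$ by $\sigma(X^*,X)$; (3) $W$ is $\frac12$-norming for $Y$, i.e. $\sup_{w\in W}|y(w)|\ge\frac12\|y\|$ for every $y\in Y$.
   Context: A non-empty bounded convex symmetric subset $W$ of a Banach space $X$ is thin if for every infinite dimensional closed subspace $V$ of $X$ there exists $\varepsilon>0$ such that for all $\lambda>0$, $B_V\not\subseteq\lambda W+\varepsilon B_X$ (where $B_V$, $B_X$ are the closed unit balls). *)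

(* Defs.v *)
From HB Require Import structures.
From mathcomp Require Import all_boot all_order all_algebra.
From mathcomp Require Import all_classical all_reals all_analysis.
Import Order.TTheory GRing.Theory Num.Theory.
Import numFieldNormedType.Exports.

Set Implicit Arguments.
Unset Strict Implicit.
Unset Printing Implicit Defensive.

Local Open Scope classical_set_scope.
Local Open Scope ring_scope.

Section sup_norm.
Context {R : realType} {T : Type}.
Implicit Types (f g : T -> R) (A : set T).

Definition sup_norm A f : R := sup [set `|f x| | x in A].

Definition bounded_on A f := exists M, forall x, A x -> `|f x| <= M.

Lemma sup_norm_ub A f x : bounded_on A f -> A x -> `|f x| <= sup_norm A f.
Proof.
move=> [M AM] Ax; apply: ub_le_sup; last by exists x.
by exists M => _ [y Ay <-]; exact: AM.
Qed.

Lemma sup_norm_le A f M : A !=set0 -> (forall x, A x -> `|f x| <= M) ->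
  sup_norm A f <= M.
Proof.
move=> [x Ax] AM; apply: ge_sup; first by exists `|f x|, x.
by move=> _ [y Ay <-]; exact: AM.
Qed.

Lemma sup_normD A f g : A !=set0 -> bounded_on A f -> bounded_on A g ->
  sup_norm A (fun x => f x + g x) <= sup_norm A f + sup_norm A g.
Proof.
move=> A0 bf bg; apply: sup_norm_le => // x Ax.
by rewrite (le_trans (ler_normD _ _))// lerD// sup_norm_ub.
Qed.

Lemma sup_normZ A f a : A !=set0 -> bounded_on A f ->
  sup_norm A (fun x => a * f x) = `|a| * sup_norm A f.
Proof.
move=> A0 bf; apply/eqP; rewrite eq_le; apply/andP; split.
  by apply: sup_norm_le => // x Ax; rewrite normrM ler_wpM2l// sup_norm_ub.
have baf : bounded_on A (fun x => a * f x).
  case: bf => M AM; exists (`|a| * M) => x Ax.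
  by rewrite normrM ler_wpM2l// AM.
have [->|a0] := eqVneq a 0.
  by case: A0 => x Ax; rewrite normr0 mul0r (le_trans (normr_ge0 (0 * f x)))//
    (sup_norm_ub (f := fun x => 0 * f x))//; case: bf => M _; exists 0 => y _;
    rewrite mul0r normr0.
rewrite -ler_pdivlMl ?normr_gt0//; apply: sup_norm_le => // x Ax.
by rewrite ler_pdivlMl ?normr_gt0// -normrM (sup_norm_ub baf).
Qed.

End sup_norm.

Definition unit_ball {R : realType} (X : normedModType R) : set X :=
  [set x | `|x| <= 1].
Arguments unit_ball {R} X.

Lemma unit_ball_neq0 {R : realType} (X : normedModType R) :
  unit_ball X !=set0.
Proof. by exists 0; rewrite /unit_ball/= normr0. Qed.

Section dual.
Context {R : realType} (X : normedModType R).

Definition dual_pred : {pred X -> R} :=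
  fun f => `[< scalar f /\ continuous f >].

Record dual := Dual { dual_fun :> X -> R ; _ : dual_fun \in dual_pred }.

HB.instance Definition _ := [isSub for dual_fun].
HB.instance Definition _ := [Choice of dual by <:].

Lemma dual_scalar (f : dual) : scalar f.
Proof. by case: f => f /= /asboolP[]. Qed.

Lemma dual_continuous (f : dual) : continuous f.
Proof. by case: f => f /= /asboolP[]. Qed.

Lemma dual_submod_closed : submod_closed dual_pred.
Proof.
split=> [|a f g /asboolP[lf cf] /asboolP[lg cg]]; apply/asboolP; split.
- by move=> k u v /=; rewrite /GRing.scale/= mulr0 addr0.
- by move=> x; exact: cst_continuous.
- move=> k u v; rewrite !fctE lf lg /GRing.scale/= !mulrDr.
  by rewrite addrACA (mulrCA k a).
- move=> x; apply: cvgD; last exact: cg.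
  by apply: cvgM; [exact: cvg_cst|exact: cf].
Qed.

HB.instance Definition _ :=
  GRing.isSubmodClosed.Build R (X -> R) dual_pred dual_submod_closed.
HB.instance Definition _ := [SubChoice_isSubLmodule of dual by <:].

Lemma dualD (f g : dual) x : (f + g) x = f x + g x.
Proof. by []. Qed.

Lemma dualZ a (f : dual) x : (a *: f) x = a * f x.
Proof. by []. Qed.

Lemma dual_at0 (f : dual) : f 0 = 0.
Proof.
have := dual_scalar f 1 0 0; rewrite scale1r addr0 mul1r => /eqP.
by rewrite -subr_eq0 opprD addNKr oppr_eq0 => /eqP.
Qed.

Lemma dual_atZ (f : dual) a x : f (a *: x) = a * f x.
Proof. by have := dual_scalar f a x 0; rewrite !addr0 dual_at0 addr0. Qed.

Lemma dual_bounded (f : dual) : bounded_on (unit_ball X) f.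
Proof.
have /cvgrPdist_le/(_ 1 ltr01) : f @ (0 : X) --> f 0 by exact: dual_continuous.
move=> /nbhs_norm0P[e /= e0 ef]; exists (2 / e) => x x1.
have e20 : 0 < e / 2 by rewrite divr_gt0.
have lt_e : `|(e / 2) *: x| < e.
  rewrite normrZ gtr0_norm// (@le_lt_trans _ _ (e / 2))//.
    by rewrite ler_piMr// ltW.
  by rewrite ltr_pdivrMr// ltr_pMr// ltr1n.
have := ef _ lt_e; rewrite /= dual_at0 sub0r normrN dual_atZ normrM gtr0_norm//.
by rewrite mulrC -ler_pdivlMr// mul1r invf_div.
Qed.

Let dual_norm (f : dual) : R := sup_norm (unit_ball X) f.

Let dual_normD (f g : dual) : dual_norm (f + g) <= dual_norm f + dual_norm g.
Proof.
by apply: sup_normD; [exact: unit_ball_neq0|exact: dual_bounded..].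
Qed.

Let dual_normZ a (f : dual) : dual_norm (a *: f) = `|a| * dual_norm f.
Proof. by apply: sup_normZ; [exact: unit_ball_neq0|exact: dual_bounded]. Qed.

Let dual_norm0 (f : dual) : dual_norm f = 0 -> f = 0.
Proof.
move=> f0; apply/val_inj/funext => x /=.
have [->|x0] := eqVneq x 0; first by rewrite dual_at0.
have : `|f (`|x|^-1 *: x)| <= dual_norm f.
  apply: sup_norm_ub; first exact: dual_bounded.
  by rewrite /unit_ball/= normrZ normfV normr_id mulVf// normr_eq0.
rewrite f0 normr_le0 dual_atZ mulf_eq0 invr_eq0 normr_eq0 (negbTE x0)/=.
by move=> /eqP.
Qed.

HB.instance Definition _ :=
  Lmodule_isNormed.Build R dual dual_normD dual_normZ dual_norm0.

Lemma dual_normE (f : dual) : `|f| = sup [set `|f x| | x in unit_ball X].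
Proof. by []. Qed.

End dual.

(* The topology sigma(X^*, X) is the one induced on X^* by the topology of
   pointwise convergence on X -> R. *)
Definition weak_star {R : realType} (X : normedModType R) : topologicalType :=
  initial_topology (fun f : dual X => (f : X -> R) : {ptws X -> R}).
Arguments weak_star {R} X.

Section c0.
Context (R : realType).

Definition c0_pred : {pred nat -> R} := fun u => `[< u @ \oo --> (0 : R) >].

Record c0 := C0 { c0_seq :> nat -> R ; _ : c0_seq \in c0_pred }.

HB.instance Definition _ := [isSub for c0_seq].
HB.instance Definition _ := [Choice of c0 by <:].

Lemma c0_cvg (u : c0) : u @ \oo --> (0 : R).
Proof. by case: u => u /= /asboolP. Qed.

Lemma c0_submod_closed : submod_closed c0_pred.
Proof.
split=> [|a u v /asboolP cu /asboolP cv]; apply/asboolP; first exact: cvg_cst.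
rewrite -[0 in X in _ --> X]addr0 -[X in _ --> X + _](mulr0 a).
by apply: cvgD => //; apply: cvgM => //; exact: cvg_cst.
Qed.

HB.instance Definition _ :=
  GRing.isSubmodClosed.Build R (nat -> R) c0_pred c0_submod_closed.
HB.instance Definition _ := [SubChoice_isSubLmodule of c0 by <:].

Lemma c0_bounded (u : c0) : bounded_on setT u.
Proof.
have /cvg_seq_bounded[M [_ /(_ (M + 1))]] : cvgn u.
  by apply/cvg_ex; exists 0; exact: c0_cvg.
by rewrite ltrDl ltr01 => /(_ isT) uM; exists (M + 1) => n _; exact: uM.
Qed.

Let c0_norm (u : c0) : R := sup_norm setT u.

Let c0_normD (u v : c0) : c0_norm (u + v) <= c0_norm u + c0_norm v.
Proof. by apply: sup_normD; [exists 0%N|exact: c0_bounded..]. Qed.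

Let c0_normZ a (u : c0) : c0_norm (a *: u) = `|a| * c0_norm u.
Proof. by apply: sup_normZ; [exists 0%N|exact: c0_bounded]. Qed.

Let c0_norm0 (u : c0) : c0_norm u = 0 -> u = 0.
Proof.
move=> u0; apply/val_inj/funext => n /=; apply/eqP.
by rewrite -normr_le0 -u0 sup_norm_ub//; exact: c0_bounded.
Qed.

HB.instance Definition _ :=
  Lmodule_isNormed.Build R c0 c0_normD c0_normZ c0_norm0.

Lemma c0_normE (u : c0) : `|u| = sup [set `|u n| | n in setT].
Proof. by []. Qed.

End c0.

Section subspaces.
Context {R : realType} {X : normedModType R}.
Implicit Types (V W : set X).

Definition closed_subspace V := submod_closed [in V] /\ closed V.

Definition finite_dimensional V := exists n (e : 'I_n -> X),
  V = [set \sum_(i < n) a i *: e i | a in [set: 'I_n -> R]].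

Definition symmetric_set W := forall x, W x -> W (- x).

Definition thin W :=
  [/\ W !=set0, bounded_set W, convex_set W, symmetric_set W &
    forall V, closed_subspace V -> ~ finite_dimensional V ->
    exists2 eps : R, 0 < eps & forall lambda : R, 0 < lambda ->
      ~ (V `&` unit_ball X `<=`
         [set lambda *: w + eps *: b | w in W & b in unit_ball X])].

(* The supremum is real-valued, hence only meaningful when W is non-empty and
   bounded. *)
Definition norming (c : R) W (Y : set (dual X)) :=
  forall y, Y y -> c * `|y| <= sup [set `|y w| | w in W].

End subspaces.

Definition separable (T : topologicalType) :=
  exists2 D : set T, countable D & dense D.

(* An isometric isomorphism of X^* onto Y, with inverse S (S is unconstrained
   outside Y), that is a homeomorphism for sigma(X^*, X) and the topology
   induced on Y by sigma(Z^*, Z). *)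
Definition isometric_weak_star_isomorphic {R : realType}
    (X Z : normedModType R) (Y : set (dual Z)) :=
  exists (T : {linear dual X -> dual Z}) (S : dual Z -> dual X),
    [/\ forall f, `|T f| = `|f|, range T = Y, cancel T S,
        continuous (T : weak_star X -> weak_star Z) &
        {within Y : set (weak_star Z),
          continuous (S : weak_star Z -> weak_star X)}].

(* Main.v *)
From HB Require Import structures.
Require Import Defs.
From mathcomp Require Import all_boot all_order all_algebra.
From mathcomp Require Import zify ring lra.
From mathcomp Require Import all_classical all_reals all_analysis.
Import Order.TTheory GRing.Theory Num.Theory.
Import numFieldNormedType.Exports.

Set Implicit Arguments.
Unset Strict Implicit.
Unset Printing Implicit Defensive.

Local Open Scope classical_set_scope.
Local Open Scope ring_scope.

(** The space [X] is the James-Lindenstrauss space over [c_0].  Let [z_i] run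
    through the finitely supported sign vectors, every one of them infinitely
    often.  The norm of a scalar sequence [x] is the supremum of
    [sqrt (sum_j `|sum_(i in I_j) x_i z_i|^2)] over all finite families of
    successive intervals [I_j], the inner norm being that of [c_0].  By duality
    it is the supremum of [sum_j b_j sum_(i in I_j) x_i z_i(m_j)] over all
    weights with [sum_j b_j^2 <= 1] and all coordinates [m_j].  The map
    [Q x = sum_i x_i z_i] is then a contraction into [c_0], and [W] is the unit
    ball of [ell_1] seen inside [X].

    Every [u] in the unit ball of [c_0] is a series [sum_k 2^-(k+1) z_(i_k)]:
    rounding [u] to a sign vector [z] leaves [u - z/2] of norm at most [1/2].
    Hence [Q] maps [W], which lies in the unit ball of [X], onto the unit ball
    of [c_0] ([quot_lift]).  All that concerns [Y] follows: the adjoint of [Q]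
    is an isometric weak-star embedding of the dual of [c_0], its range [Y] is
    the annihilator of the kernel of [Q], and [W] is even 1-norming for [Y].

    Thinness and separability of the dual rest on two properties of successive
    blocks.  Functionals of norm one acting on [N] successive blocks have a sum
    of norm at most [sqrt N], because their weights are added in the [ell_2]
    sense.  Vectors [v_1, .., v_N] of norm one that are successive blocks, and
    whose images [Q v_k] are successive blocks too, also have a sum of norm
    [O(sqrt N)] ([almost_blocks_norm]): on [v_k], an interval functional that
    neither starts nor stops inside the block is 0 or a coordinate of [Q], and
    each coordinate of [c_0] sees a single block, so that every interval
    meets at most three blocks in an essential way.

    For thinness, an infinite-dimensional [V] contains such blocks, for it meets
    every subspace of finite codimension.  Let [s_k] norm [v_k].  Then
    [N^(-1/2) sum_k s_k] has norm at most one, is bounded below at a multiple of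
    [N^(-1/2) sum_k v_k] that lies in the unit ball of [V], and is at most
    [N^(-1/2)] on [W], since [W] only sees the largest weight of a functional.

    For separability, the same blocks show that a functional [f] is uniformly
    small on the subspaces [x_i = 0, (Q x)_m = 0] ([i, m < n]) for [n] large
    ([dual_small_on_tail_kernel]).  The lifting property then yields a linear
    combination of finitely many coordinates of [x] and of [Q x] that is close
    to [f] in norm. *)

(** * Sign vectors in the unit ball of [c_0] *)

Section signs.
Context {R : realType}.

(** The exponent of 2 in [i], and not [i] itself, is decoded: every code is then
    attained at arbitrarily large indices. *)
Definition sign_code (i : nat) : bool * seq (option bool) :=
  odflt (true, [::]) (unpickle (logn 2 i)).

Definition digit (d : option bool) : R :=
  if d is Some b then (if b then 1 else -1) else 0.

(** The first entry comes from a boolean, so it is never zero; this makes each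
    coordinate of a sequence visible to the norm below ([JL_coord_le]). *)
Definition sgnv (i m : nat) : R :=
  digit (nth None (Some (sign_code i).1 :: (sign_code i).2) m).

Lemma sign_code_surj c n : exists2 i, (n <= i)%N & sign_code i = c.
Proof.
exists (2 ^ pickle c * (2 * n).+1)%N.
  by apply: (@leq_trans (1 * (2 * n).+1)); [lia|rewrite leq_mul2r expn_gt0].
rewrite /sign_code lognM ?expn_gt0// pfactorK//.
rewrite (_ : logn 2 (2 * n).+1 = 0%N) ?addn0 ?pickleK//.
by rewrite lognE/= dvdn2/= oddM/=.
Qed.

Lemma sgnv_le1 i m : `|sgnv i m| <= 1.
Proof.
by rewrite /sgnv/digit; case: nth => [[]|]; rewrite ?normrN ?normr1 ?normr0.
Qed.

Lemma sgnv0 i : `|sgnv i 0| = 1.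
Proof. by rewrite /sgnv/digit/=; case: ifP; rewrite ?normrN normr1. Qed.

Lemma sgnv_finite i : exists M, forall m, (M <= m)%N -> sgnv i m = 0.
Proof.
exists (size (sign_code i).2).+1 => m Mm.
by rewrite /sgnv nth_default.
Qed.

(** The entries of absolute value above [1/2] are rounded to their sign and the
    others to 0, except that the first one is always rounded to its sign.  Either
    way the error after subtracting one half of the rounding is at most [1/2].
    Only finitely many entries are above [1/2], as [u] tends to 0. *)
Lemma sgnv_halving (u : c0 R) n : (forall m, `|u m| <= 1) ->
  exists2 i, (n <= i)%N & forall m, `|u m - 2^-1 * sgnv i m| <= 2^-1.
Proof.
move=> u1.
have /cvgrPdist_le/(_ 2^-1)[|M _ uM] := c0_cvg u.
  by rewrite invr_gt0.
pose e (x : R) : option bool :=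
  if `|x| <= 2^-1 then None else Some (0 <= x).
have [i ni ci] := sign_code_surj (0 <= u 0%N, mkseq (fun m => e (u m.+1)) M) n.
exists i => // m.
have := u1 m; rewrite !ler_norml => /andP[um1 um2].
rewrite /sgnv ci {ci}; case: m um1 um2 => [|m] /= um1 um2.
  by case: (lerP 0 (u 0%N)) => u0; apply/andP; split; lra.
have [mM|Mm] := ltnP m M.
  rewrite nth_mkseq// /e; case: ifPn => /=.
    by rewrite mulr0 subr0 ler_norml.
  rewrite ler_norml negb_and -!ltNge.
  by case: (lerP 0 (u m.+1)) => u0 /orP[] H; apply/andP; split; lra.
rewrite nth_default ?size_mkseq//= mulr0 subr0 -ler_norml.
by have := uM m.+1 (leqW Mm); rewrite /= sub0r normrN.
Qed.

End signs.

(** * Interval functionals *)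

Section pieces.
Context {R : realType}.
Implicit Types (x : nat -> R) (i m p q n : nat).

(** The piece [(b, m, p, q)] stands for the functional
    [x |-> b * sum_(p <= i < q) x_i z_i(m)], where [z_i] is [sgnv i]. *)
Definition piece := (R * nat * nat * nat)%type.
Definition wt (c : piece) : R := c.1.1.1.
Definition crd (c : piece) : nat := c.1.1.2.
Definition lo (c : piece) : nat := c.1.2.
Definition hi (c : piece) : nat := c.2.

Implicit Types (c : piece) (s : seq piece).

Definition segsum x m p q : R := \sum_(p <= i < q) x i * sgnv i m.

Definition pairing s x : R :=
  \sum_(c <- s) wt c * segsum x (crd c) (lo c) (hi c).

Definition energy s : R := \sum_(c <- s) wt c ^+ 2.

(** Successiveness is required of all pairs of pieces, not just of neighbours:
    the interval of a piece may be empty, and then it separates nothing. *)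
Definition successive s := pairwise (fun c d => (hi c <= lo d)%N) s.

(** The norming set of the James-Lindenstrauss space. *)
Definition admissible : set (seq piece) :=
  [set s | successive s /\ energy s <= 1].

Lemma admissible_neq0 : admissible !=set0.
Proof. by exists [::]; split=> //; rewrite /energy big_nil. Qed.

Lemma segsum_linear m p q a x y :
  segsum (a *: x + y) m p q = a * segsum x m p q + segsum y m p q.
Proof.
rewrite /segsum mulr_sumr -big_split; apply: eq_bigr => i _ /=.
by rewrite !fctE mulrDl mulrA.
Qed.

Lemma segsum_cat x m p n q : (p <= n <= q)%N ->
  segsum x m p q = segsum x m p n + segsum x m n q.
Proof. by move=> /andP[pn nq]; exact: big_cat_nat. Qed.

Lemma segsum_geq x m p q : (q <= p)%N -> segsum x m p q = 0.
Proof. exact: big_geq. Qed.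

Lemma segsum_split x m p q n :
  segsum x m p q = segsum x m p (minn q n) + segsum x m (maxn p n) q.
Proof.
have [qn|nq] := leqP q n.
  by rewrite (segsum_geq _ _ (leq_trans qn (leq_maxr _ _))) addr0.
have [pn|np] := leqP p n; first by rewrite -segsum_cat// pn ltnW.
by rewrite [X in X + _]segsum_geq ?add0r// ltnW.
Qed.

Lemma segsum_eq0 x m p q n : (forall i, (i < n)%N -> x i = 0) -> (q <= n)%N ->
  segsum x m p q = 0.
Proof.
move=> x0 qn; rewrite /segsum big_nat big1// => i /andP[_ iq].
by rewrite x0 ?mul0r// (leq_trans iq).
Qed.

Lemma pairing_linear s a x y :
  pairing s (a *: x + y) = a * pairing s x + pairing s y.
Proof.
rewrite /pairing mulr_sumr -big_split; apply: eq_bigr => c _ /=.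
by rewrite segsum_linear mulrDr mulrCA.
Qed.

Lemma pairing_cat s t x : pairing (s ++ t) x = pairing s x + pairing t x.
Proof. exact: big_cat. Qed.

Lemma energy_cat s t : energy (s ++ t) = energy s + energy t.
Proof. exact: big_cat. Qed.

Lemma energy_ge0 s : 0 <= energy s.
Proof. by apply: sumr_ge0 => c _; rewrite sqr_ge0. Qed.

Lemma energy_wt_le1 s : energy s <= 1 -> all (fun c => `|wt c| <= 1) s.
Proof.
move=> s1; apply/allP => c cs.
rewrite -(@ler_pXn2r _ 2)// ?nnegrE// expr1n real_normK ?num_real//.
apply: le_trans s1; rewrite /energy (perm_big _ (perm_to_rem cs)) big_cons.
by rewrite lerDl sumr_ge0// => ? _; rewrite sqr_ge0.
Qed.

Definition rescale (a : R) s := [seq (a * wt c, crd c, lo c, hi c) | c <- s].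

Lemma pairing_rescale a s x : pairing (rescale a s) x = a * pairing s x.
Proof.
rewrite /pairing big_map mulr_sumr; apply: eq_bigr => c _.
by rewrite mulrA.
Qed.

Lemma energy_rescale a s : energy (rescale a s) = a ^+ 2 * energy s.
Proof.
rewrite /energy big_map mulr_sumr; apply: eq_bigr => c _.
by rewrite exprMn.
Qed.

Lemma successive_rescale a s : successive (rescale a s) = successive s.
Proof. by rewrite /successive pairwise_map. Qed.

(** [cut_above n s] and [cut_below n s] are [s] applied to the part of a sequence
    before [n], resp. from [n] on.  Truncating the functional instead of the
    vector avoids introducing the projections of the space. *)
Definition cut_above n s := [seq (wt c, crd c, lo c, minn (hi c) n) | c <- s].
Definition cut_below n s := [seq (wt c, crd c, maxn (lo c) n, hi c) | c <- s].

Lemma pairing_cut n s x :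
  pairing s x = pairing (cut_above n s) x + pairing (cut_below n s) x.
Proof.
rewrite /pairing !big_map -big_split; apply: eq_bigr => c _ /=.
by rewrite -mulrDr -segsum_split.
Qed.

Lemma energy_cut_above n s : energy (cut_above n s) = energy s.
Proof. by rewrite /energy big_map. Qed.

Lemma energy_cut_below n s : energy (cut_below n s) = energy s.
Proof. by rewrite /energy big_map. Qed.

Lemma successive_cut_above n s : successive s -> successive (cut_above n s).
Proof.
rewrite /successive pairwise_map; apply: sub_pairwise => c d /=.
by move=> cd; rewrite /hi/lo/=; apply: leq_trans (geq_minl _ _) _.
Qed.

Lemma successive_cut_below n s : successive s -> successive (cut_below n s).
Proof.
rewrite /successive pairwise_map; apply: sub_pairwise => c d /=.
by move=> cd; rewrite /hi/lo/=; apply: leq_trans (leq_maxl _ _).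
Qed.

Lemma cut_below_lo n s : all (fun c => (n <= lo c)%N) (cut_below n s).
Proof. by rewrite all_map; apply/allP => c _ /=; exact: leq_maxr. Qed.

Lemma successive_cat s t n : successive s -> successive t ->
  all (fun c => (hi c <= n)%N) s -> all (fun c => (n <= lo c)%N) t ->
  successive (s ++ t).
Proof.
move=> ss st sn tn; rewrite /successive pairwise_cat; apply/and3P; split=> //.
apply/allrelP => c d cs dt.
exact: leq_trans (allP sn _ cs) (allP tn _ dt).
Qed.

Lemma pairing_eq0 s x n : (forall i, (i < n)%N -> x i = 0) ->
  all (fun c => (hi c <= n)%N) s -> pairing s x = 0.
Proof.
move=> x0 sn; rewrite /pairing big_seq big1// => c cs.
by rewrite (segsum_eq0 _ _ x0) ?mulr0// (allP sn).
Qed.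

Lemma hi_bounded s : exists n, all (fun c => (hi c <= n)%N) s.
Proof.
exists (\max_(c <- s) hi c)%N; apply/allP => c cs.
exact: (@leq_bigmax_seq _ _ _ hi).
Qed.

(** The pieces are pairwise disjoint: all pieces after the one that covers [i]
    start beyond [i]. *)
Lemma successive_count s i : successive s ->
  (count (fun c => (lo c <= i < hi c)%N) s <= 1)%N.
Proof.
elim: s => [//|c s IH] /= /andP[/allP cs ss].
have [/andP[ci ic]|_] /= := boolP (lo c <= i < hi c)%N; last by rewrite IH.
rewrite (@eq_in_count _ _ pred0) ?count_pred0// => d ds.
by apply/negP => /andP[di _]; have := cs _ ds; lia.
Qed.

Lemma successive_sum_le s i : successive s ->
  \sum_(c <- s | (lo c <= i < hi c)%N) (1 : R) <= 1.
Proof.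
move=> ss; rewrite big_const_seq iter_addr_0 -[leRHS]/(1%:R) ler_nat.
exact: successive_count.
Qed.

Definition l1ball : set (nat -> R) :=
  [set x | forall n, \sum_(0 <= i < n) `|x i| <= 1].

(** This is what makes the unit ball of [ell_1] small for the dual norm: only the
    largest weight counts, whereas admissibility restricts the sum of squares. *)
Lemma pairing_l1ball s x a : l1ball x -> successive s ->
  all (fun c => `|wt c| <= a) s -> 0 <= a -> `|pairing s x| <= a.
Proof.
move=> x1 ss /allP sa a0; have [M /allP sM] := hi_bounded s.
rewrite (le_trans (ler_norm_sum _ _ _))//.
have H : \sum_(c <- s) `|wt c * segsum x (crd c) (lo c) (hi c)| <=
    a * \sum_(c <- s) \sum_(0 <= i < M | (lo c <= i < hi c)%N) `|x i|.
  rewrite mulr_sumr big_seq [leRHS]big_seq; apply: ler_sum => c cs.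
  rewrite normrM ler_pM// ?sa//.
  rewrite (le_trans (ler_norm_sum _ _ _))// big_nat (@big_nat_widenl _ _ _ _ 0)//=.
  rewrite (big_nat_widen _ _ M) ?sM//=.
  rewrite [leLHS](eq_bigl (fun i => (lo c <= i < hi c)%N)); last first.
    by move=> i; lia.
  apply: ler_sum => i _; rewrite normrM ler_piMr// sgnv_le1//.
apply: le_trans H _; rewrite -[leRHS]mulr1 ler_wpM2l//.
rewrite (exchange_big_dep predT)//=.
apply: le_trans (x1 M); apply: ler_sum => i _.
rewrite [leLHS](_ : _ =
  (\sum_(c <- s | (lo c <= i < hi c)%N) 1) * `|x i|).
  by rewrite ler_piMl// successive_sum_le.
by rewrite mulr_suml; apply: eq_bigr => c _; rewrite mul1r.
Qed.

End pieces.

(** * The James-Lindenstrauss space over [c_0] *)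

Lemma scalar_bounded_continuous {R : realType} (X : normedModType R)
    (f : X -> R) (C : R) : scalar f -> (forall x, `|f x| <= C * `|x|) ->
  continuous f.
Proof.
move=> lf fC x; apply/cvgrPdist_le => e e0.
have fB u v : f u - f v = f (u - v).
  by rewrite [u - v]addrC -[- v]scaleN1r lf mulN1r addrC.
have C1 : 0 < `|C| + 1 by rewrite ltr_pwDr.
near=> t; rewrite fB (le_trans (fC _))//.
rewrite (@le_trans _ _ ((`|C| + 1) * `|x - t|))//.
  by rewrite ler_wpM2r// (le_trans (ler_norm _))// lerDl.
rewrite -ler_pdivlMl// mulrC; near: t.
by apply: cvgr_dist_le; rewrite ?divr_gt0//; exact: cvg_id.
Unshelve. all: by end_near. Qed.

Section James_Lindenstrauss.
Context (R : realType).

Definition JL_pred : {pred nat -> R} :=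
  fun x => `[< bounded_on admissible (fun s => pairing s x) >].

Record JL := MkJL { JL_seq :> nat -> R ; _ : JL_seq \in JL_pred }.

HB.instance Definition _ := [isSub for JL_seq].
HB.instance Definition _ := [Choice of JL by <:].

Lemma JL_bounded (x : JL) : bounded_on admissible (fun s => pairing s x).
Proof. by case: x => x /= /asboolP. Qed.

Lemma pairing0 s : pairing s (0 : nat -> R) = 0.
Proof.
by rewrite /pairing big1// => c _; rewrite /segsum big1 ?mulr0// => i _; rewrite mul0r.
Qed.

Lemma JL_submod_closed : submod_closed JL_pred.
Proof.
split=> [|a x y /asboolP[M xM] /asboolP[N yN]]; apply/asboolP.
  by exists 0 => s _; rewrite pairing0 normr0.
exists (`|a| * M + N) => s Ks; rewrite pairing_linear.
by rewrite (le_trans (ler_normD _ _))// lerD ?yN// normrM ler_wpM2l// xM.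
Qed.

HB.instance Definition _ :=
  GRing.isSubmodClosed.Build R (nat -> R) JL_pred JL_submod_closed.
HB.instance Definition _ := [SubChoice_isSubLmodule of JL by <:].

Let JL_norm (x : JL) : R := sup_norm admissible (fun s => pairing s x).

Lemma pairingD s (x y : JL) : pairing s (x + y) = pairing s x + pairing s y.
Proof. by rewrite -[x]scale1r pairing_linear mul1r scale1r. Qed.

Lemma pairingZ s a (x : JL) : pairing s (a *: x) = a * pairing s x.
Proof. by rewrite -[a *: x]addr0 pairing_linear pairing0 addr0. Qed.

Lemma pairing_sum s n (v : nat -> JL) :
  pairing s (\sum_(k < n) v k) = \sum_(k < n) pairing s (v k).
Proof.
elim/big_ind2 : _ => [|x a y b xa yb|//]; first exact: pairing0.
by rewrite pairingD xa yb.
Qed.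

Let JL_normD (x y : JL) : JL_norm (x + y) <= JL_norm x + JL_norm y.
Proof.
rewrite /JL_norm.
under [X in sup_norm _ X]eq_fun do rewrite pairingD.
by apply: sup_normD; [exact: admissible_neq0|exact: JL_bounded..].
Qed.

Let JL_normZ a (x : JL) : JL_norm (a *: x) = `|a| * JL_norm x.
Proof.
rewrite /JL_norm.
under [X in sup_norm _ X]eq_fun do rewrite pairingZ.
by apply: sup_normZ; [exact: admissible_neq0|exact: JL_bounded].
Qed.

Lemma segsum_pairing m p q (x : nat -> R) :
  segsum x m p q = pairing [:: (1, m, p, q)] x.
Proof. by rewrite /pairing big_seq1 mul1r. Qed.

Lemma admissible1 m p q : admissible [:: (1 : R, m, p, q)].
Proof. by split=> //; rewrite /energy big_seq1 expr1n. Qed.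

(* the first entry of [sgnv i] has absolute value 1 *)
Let coord_le (x : JL) i : `|x i| <= JL_norm x.
Proof.
rewrite -[leLHS]mulr1 -(sgnv0 i) -normrM.
have -> : x i * sgnv i 0 = segsum x 0 i i.+1 by rewrite /segsum big_nat1.
rewrite segsum_pairing.
by apply: (sup_norm_ub (f := fun s => pairing s x)); [exact: JL_bounded|exact: admissible1].
Qed.

Let JL_norm0 (x : JL) : JL_norm x = 0 -> x = 0.
Proof.
move=> x0; apply/val_inj/funext => i /=; apply/eqP.
by rewrite -normr_le0 -x0 coord_le.
Qed.

HB.instance Definition _ :=
  Lmodule_isNormed.Build R JL JL_normD JL_normZ JL_norm0.

Implicit Types (x y : JL) (i m p q n : nat).

Lemma JL_coord_le x i : `|x i| <= `|x|.
Proof. exact: coord_le. Qed.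

Lemma JL_coord_linear a x y i : (a *: x + y) i = a * x i + y i.
Proof. by []. Qed.

Lemma JL_norm_le x (C : R) : (forall s, admissible s -> `|pairing s x| <= C) ->
  `|x| <= C.
Proof. by apply: sup_norm_le; exact: admissible_neq0. Qed.

Lemma pairing_le_norm s x : admissible s -> `|pairing s x| <= `|x|.
Proof. by apply: sup_norm_ub; exact: JL_bounded. Qed.

Lemma pairing_le s x e : 0 < e -> successive s -> energy s <= e ^+ 2 ->
  `|pairing s x| <= e * `|x|.
Proof.
move=> e0 ss se; rewrite -ler_pdivrMl//.
rewrite -[X in X * _]gtr0_norm ?invr_gt0// -normrM -pairing_rescale.
apply: pairing_le_norm; split; first by rewrite successive_rescale.
by rewrite energy_rescale exprVn ler_pdivrMl ?exprn_gt0// mulr1.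
Qed.

Lemma segsum_le x m p q : `|segsum x m p q| <= `|x|.
Proof. by rewrite segsum_pairing; apply/pairing_le_norm/admissible1. Qed.

Lemma JL_exists_functional x a : a < `|x| ->
  exists s, admissible s /\ a < pairing s x.
Proof.
move=> ax; apply: contrapT => /forallNP H.
suff : `|x| <= a by rewrite leNgt ax.
apply: JL_norm_le => s [ss se]; rewrite leNgt lter_normr; apply/negP => /orP[] sa.
  by apply: (H s).
apply: (H (rescale (-1) s)); split; last by rewrite pairing_rescale mulN1r.
by split; rewrite ?successive_rescale// energy_rescale sqrrN expr1n mul1r.
Qed.

Lemma cvg_pairing {T} (F : set_system T) {FF : Filter F} (f : T -> nat -> R)
    (l : nat -> R) s : (forall i, f t i @[t --> F] --> l i) ->
  pairing s (f t) @[t --> F] --> pairing s l.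
Proof.
move=> fl; rewrite /pairing; apply: cvg_big => [|c _].
  by apply: add_continuous.
apply: cvgM; first exact: cvg_cst.
rewrite /segsum; apply: cvg_big => [|i _]; first exact: add_continuous.
by apply: cvgM => //; exact: cvg_cst.
Qed.

(** A Cauchy filter converges coordinatewise, and each functional of the norming
    set depends on finitely many coordinates, so the uniform estimates pass to
    the limit. *)
Lemma JL_complete (F : set_system JL) : ProperFilter F -> cauchy F -> cvg F.
Proof.
move=> FF /cauchyP Fc.
have cF i : cvg ((fun x : JL => x i) @ F).
  apply: cauchy_cvg; apply: cauchy_exP => e e0; have [x Fx] := Fc e e0.
  exists (x i); apply: (@filterS _ F _ _ [set y : JL | ball (x i) e (y i)]) Fx.
  move=> y; rewrite -!ball_normE/=; apply: le_lt_trans.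
  exact: (JL_coord_le (x - y) i).
pose l i := lim ((fun x : JL => x i) @ F).
have near_l e : 0 < e -> exists2 x : JL, F (ball x e) &
    forall s, admissible s -> `|pairing s (l - JL_seq x)| <= e.
  move=> e0; have [x Fx] := Fc e e0; exists x => // s Ks.
  have : pairing s ((y : JL) - x) @[y --> F] --> pairing s (l - JL_seq x).
    apply: (@cvg_pairing _ _ _ (fun y : JL => JL_seq y - JL_seq x)) => i.
    by apply: cvgB; [exact: cF|exact: cvg_cst].
  move=> /cvg_norm /cvgr_to_le; apply; apply: filterS Fx => y.
  rewrite -ball_normE/= distrC => /ltW; apply: le_trans.
  exact: (pairing_le_norm (y - x)).
have lJL : l \in JL_pred.
  apply/asboolP; have [x _ xl] := near_l 1 ltr01.
  exists (1 + `|x|) => s Ks.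
  rewrite -(subrK (JL_seq x) l) -[X in pairing _ (X + _)]scale1r pairing_linear.
  rewrite mul1r (le_trans (ler_normD _ _))// lerD ?xl//.
  exact: pairing_le_norm.
apply/cvg_ex; exists (MkJL lJL); apply/cvgrPdist_le => e e0.
have [x Fx xl] := near_l (e / 2) (divr_gt0 e0 (ltr0Sn R 1)).
apply: filterS Fx => y; rewrite -ball_normE/= => /ltW xy.
rewrite -(subrKA x) [e]splitr (le_trans (ler_normD _ _))// lerD//.
by apply: JL_norm_le => s Ks; exact: xl.
Qed.

HB.instance Definition _ := Uniform_isComplete.Build JL JL_complete.

Lemma l1ball_JL (a : nat -> R) : l1ball a -> a \in JL_pred.
Proof.
move=> a1; apply/asboolP; exists 1 => s [ss /energy_wt_le1 s1].
exact: pairing_l1ball.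
Qed.

(** The tails of a vector tend to 0 in norm.  Otherwise some [N] successive
    functionals of norm one, each larger than [e] at [x], add up to a functional
    of norm at most [sqrt N] larger than [N e] at [x]; this is false for large
    [N]. *)
Lemma JL_tail x e : 0 < e -> exists n, forall s, admissible s ->
  all (fun c => (n <= lo c)%N) s -> `|pairing s x| <= e.
Proof.
move=> e0; apply: contrapT => /forallNP H.
have step n : exists s, [/\ admissible s, all (fun c => (n <= lo c)%N) s &
    e < pairing s x].
  have /existsNP[s /not_implyP[[ss se] /not_implyP[sn /negP]]] := H n.
  rewrite -ltNge lter_normr => /orP[] sx; first by exists s.
  exists (rescale (-1) s); split; last by rewrite pairing_rescale mulN1r.
    by split; rewrite ?successive_rescale// energy_rescale sqrrN expr1n mul1r.
  by rewrite all_map.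
have build (N : nat) : exists s, [/\ successive s, energy s <= N%:R &
    N%:R * e <= pairing s x].
  elim: N => [|N [s [ss sN sx]]].
    by exists [::]; rewrite /energy /pairing !big_nil mul0r.
  have [n sn] := hi_bounded s; have [t [[tt te] tn tx]] := step n.
  exists (s ++ t); split; first exact: successive_cat tn.
    by rewrite energy_cat -natr1 lerD.
  by rewrite pairing_cat -natr1 mulrDl mul1r lerD// ltW.
(* the number of functionals is a square, so that its root is a natural number *)
pose K := (Num.truncn (`|x| / e)).+1.
have xK : `|x| / e < K%:R by rewrite truncnS_gt.
have [s [ss sK sx]] := build (K ^ 2)%N.
have K0 : (0 : R) < K%:R by rewrite ltr0n.
rewrite natrX in sK sx.
have := le_trans sx (le_trans (ler_norm _) (pairing_le x K0 ss sK)).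
rewrite expr2 -mulrA ler_pM2l// leNgt -ltr_pdivrMr// xK//.
Qed.

End James_Lindenstrauss.

(** * The map onto [c_0] *)

Section quotient_map.
Context {R : realType}.
Implicit Types (x v : JL R) (i m p q n : nat).

Lemma segsum_tail x e : 0 < e ->
  exists n, forall p m q, (n <= p)%N -> `|segsum x m p q| <= e.
Proof.
move=> e0; have [n xn] := JL_tail x e0; exists n => p m q np.
by rewrite segsum_pairing xn//= ?np//; exact: admissible1.
Qed.

Lemma is_cvg_segsum x m : cvgn (segsum x m 0).
Proof.
apply: cauchy_cvg; apply/cauchy_seriesP => e e0.
have [n xn] := segsum_tail x (divr_gt0 e0 (ltr0Sn R 1)).
exists ([set p | (n <= p)%N], setT).
  by split; [exists n|exact: filterT].
move=> [p q] [/= np _]; rewrite (@le_lt_trans _ _ (e / 2))//; first exact: xn.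
by rewrite ltr_pdivrMr// ltr_pMr// ltr1n.
Qed.

(** The [m]-th coordinate of [sum_i x_i z_i]. *)
Definition qcoord m x : R := limn (segsum x m 0).

Lemma cvg_qcoord m x : segsum x m 0 @ \oo --> qcoord m x.
Proof. exact: is_cvg_segsum. Qed.

Lemma qcoord_scalar m : scalar (qcoord m).
Proof.
move=> a x y; apply: cvg_lim => //=.
rewrite (_ : segsum _ m 0 = fun n => a * segsum x m 0 n + segsum y m 0 n).
  by apply: cvgD; [apply: cvgM; [exact: cvg_cst|]|]; exact: cvg_qcoord.
by apply/funext => n; exact: segsum_linear.
Qed.

HB.instance Definition _ m :=
  GRing.isLinear.Build R (JL R) R _ (qcoord m) (qcoord_scalar m).

Lemma qcoord_le m x : `|qcoord m x| <= `|x|.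
Proof.
apply: (cvgr_to_le (cvg_norm (@cvg_qcoord m x))).
by near=> n; exact: segsum_le.
Unshelve. all: by end_near. Qed.

Lemma qcoord_tail m x n e : (forall q, `|segsum x m n q| <= e) ->
  `|qcoord m x - segsum x m 0 n| <= e.
Proof.
move=> xe.
have : (fun q => segsum x m 0 q - segsum x m 0 n) @ \oo --> qcoord m x - segsum x m 0 n.
  by apply: cvgB; [exact: cvg_qcoord|exact: cvg_cst].
move=> /cvg_norm/cvgr_to_le; apply; exists n => // q /= nq.
by rewrite (@segsum_cat _ _ _ 0 n q)//= addrAC subrr add0r.
Qed.

Lemma cvg_segsum_crd (x : nat -> R) p q : (fun m => segsum x m p q) @ \oo --> (0 : R).
Proof.
have -> : (0 : R) = \sum_(p <= i < q) 0 by rewrite big1_eq.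
apply: cvg_big => [|i _]; first exact: add_continuous.
rewrite -[X in _ --> X](mulr0 (x i)); apply: cvgM; first exact: cvg_cst.
have [M Mi] := @sgnv_finite R i.
apply/cvgrPdist_le => e e0; exists M => // m /= Mm.
by rewrite Mi// subrr normr0 ltW.
Qed.

(** By [segsum_tail] the partial sums converge uniformly in the coordinate [m],
    and each of them has finite support in [m]. *)
Lemma qcoord_c0 x : (qcoord ^~ x) \in @c0_pred R.
Proof.
apply/asboolP/cvgrPdist_le => e e0.
have e20 : 0 < e / 2 by rewrite divr_gt0.
have [n xn] := segsum_tail x e20.
have /cvgrPdist_le/(_ _ e20)[M _ xM] := cvg_segsum_crd x 0 n.
exists M => // m /= Mm; rewrite sub0r normrN -(subrK (segsum x m 0 n) (qcoord m x)).
rewrite [e]splitr (le_trans (ler_normD _ _))// lerD//.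
  by apply: qcoord_tail => q; exact: xn.
by have := xM m Mm; rewrite /= sub0r normrN.
Qed.

Definition quot x : c0 R := C0 (qcoord_c0 x).

Lemma quot_linear a x y : quot (a *: x + y) = a *: quot x + quot y.
Proof. by apply/val_inj/funext => m; exact: qcoord_scalar. Qed.

HB.instance Definition _ :=
  GRing.isLinear.Build R (JL R) (c0 R) _ quot quot_linear.

Lemma c0_norm_le (u : c0 R) (C : R) : (forall m, `|u m| <= C) -> `|u| <= C.
Proof. by move=> uC; apply: sup_norm_le; [exists 0%N|move=> m _; exact: uC]. Qed.

Lemma c0_coord_le (u : c0 R) m : `|u m| <= `|u|.
Proof. by apply: sup_norm_ub => //; exact: c0_bounded. Qed.

Lemma quot_le x : `|quot x| <= `|x|.
Proof. by apply: c0_norm_le => m; exact: qcoord_le. Qed.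

End quotient_map.

(** * Upper estimate for successive blocks *)

Section upper_estimate.
Context {R : realType}.
Implicit Types (x v : JL R) (i m p q n : nat).

(** Approximate double blocks: successive in the space and, through the quotient
    map, in [c_0].  Vectors of a given subspace can only be truncated up to
    [eta]; the vanishing of the entries before [r] is exact because it is a
    finite set of linear equations. *)
Definition almost_block (eta : R) (r r' : nat) v :=
  [/\ (r < r')%N,
    forall i, (i < r)%N -> v i = 0,
    `|v| <= 1,
    forall s, admissible s -> all (fun c => (r' <= lo c)%N) s ->
      `|pairing s v| <= eta &
    forall m, ~~ (r <= m < r')%N -> `|qcoord m v| <= eta].

(** Both tails, of [v] and of its image in [c_0], are eventually below [eta]. *)
Lemma almost_block_exists v r eta : 0 < eta -> `|v| <= 1 ->
  (forall i, (i < r)%N -> v i = 0) -> (forall m, (m < r)%N -> qcoord m v = 0) ->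
  exists r0, forall r', (r0 <= r')%N -> almost_block eta r r' v.
Proof.
move=> eta0 v1 v0 q0; have [n vn] := JL_tail v eta0.
have /cvgrPdist_le/(_ _ eta0)[M _ vM] := c0_cvg (quot v).
exists (r.+1 + n + M)%N => r' rr'; split=> //; first lia.
  move=> s Ks sr'; apply: vn => //; apply: sub_all sr' => c; lia.
move=> m; have [mr _|rm /= mr'] := ltnP m r; first by rewrite q0// normr0 ltW.
have Mm : (M <= m)%N by lia.
by have := vM m Mm; rewrite /= sub0r normrN.
Qed.

(** Any other piece acts on a block almost like 0 or like a coordinate of the
    quotient map that is small on the block; only these need an energy bound. *)
Definition anchored r r' (c : @piece R) :=
  [|| (r <= crd c < r')%N, (r <= lo c < r')%N | (r <= hi c < r')%N].

(** Unless the interval of the piece covers the block, it misses it; if it covers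
    it, then the sum over the interval is almost the full sum, which is a
    coordinate of the image outside [[r, r')] and hence at most [eta]. *)
Lemma almost_block_unanchored eta r r' v c : 0 <= eta -> almost_block eta r r' v ->
  ~~ anchored r r' c ->
  `|segsum v (crd c) (lo c) (minn (hi c) r')| <=
    (lo c <= r < hi c)%N%:R * (eta + eta).
Proof.
move=> eta0 [rr' v0 v1 vt vq]; rewrite /anchored => /norP[cm /norP[cl ch]].
have [rl|lr] := leqP r (lo c).
  have -> : segsum v (crd c) (lo c) (minn (hi c) r') = 0 by apply: segsum_geq; lia.
  by rewrite normr0 mulr_ge0// addr_ge0.
have [hr|rh] := leqP (hi c) r.
  rewrite (segsum_eq0 _ _ v0); last by lia.
  by rewrite normr0 mulr_ge0// addr_ge0.
have -> : (lo c <= r)%N = true by lia.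
rewrite /= mul1r (_ : minn _ _ = r'); last by lia.
have -> : segsum v (crd c) (lo c) r' = segsum v (crd c) 0 r'.
  rewrite [RHS](@segsum_cat _ _ _ 0 (lo c) r'); last by lia.
  by rewrite [X in _ = X + _](segsum_eq0 _ _ v0) ?add0r//; lia.
rewrite -[X in `|X|](subrK (qcoord (crd c) v)) (le_trans (ler_normD _ _))//.
rewrite lerD ?vq// distrC; apply: qcoord_tail => q.
by rewrite segsum_pairing; apply: vt => /=; [exact: admissible1|rewrite leqnn].
Qed.

(** The anchored pieces contribute at most the square root of their energy [E],
    which is bounded by [(t E + 1/t) / 2]; this linear bound can be summed over
    blocks.  At most one of the other pieces covers the block. *)
Lemma almost_block_pairing eta r r' v s t : 0 <= eta -> 0 < t ->
  almost_block eta r r' v -> admissible s ->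
  `|pairing s v| <= (t * energy [seq c <- s | anchored r r' c] + t^-1) / 2 + 3 * eta.
Proof.
move=> eta0 t0 vb [ss se].
have {ss se} [ss s1] := (ss, energy_wt_le1 se, conj ss se).
rewrite (pairing_cut r') (le_trans (ler_normD _ _))//.
have -> : 3 * eta = (eta + eta) + eta by ring.
rewrite addrA lerD//; last first.
  have [_ _ _ vt _] := vb; apply: vt; last exact: cut_below_lo.
  by split; [exact: successive_cut_below (proj1 s1)|rewrite energy_cut_below (proj2 s1)].
case: ss => ss ws.
rewrite /pairing big_map (bigID (anchored r r'))/= (le_trans (ler_normD _ _))//.
rewrite lerD//.
  set E := energy _.
  have e0 : 0 < (t * E + t^-1) / 2.
    by rewrite divr_gt0// ltr_wpDl ?invr_gt0// mulr_ge0 ?energy_ge0 ?ltW.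
  rewrite -[leRHS]mulr1; case: vb => _ _ v1 _ _.
  apply: le_trans (ler_wpM2l (ltW e0) v1).
  have -> : \sum_(c <- s | anchored r r' c)
      wt c * segsum v (crd c) (lo c) (minn (hi c) r') =
      pairing (cut_above r' [seq c <- s | anchored r r' c]) v.
    by rewrite /pairing big_map big_filter.
  apply: pairing_le => //.
    by apply: successive_cut_above; exact: pairwise_filter.
  rewrite energy_cut_above -/E.
  have E0 : 0 <= E by exact: energy_ge0.
  (* arithmetic-geometric mean inequality *)
  have -> : ((t * E + t^-1) / 2) ^+ 2 = E + ((t * E - t^-1) / 2) ^+ 2.
    by field; rewrite gt_eqF.
  by rewrite lerDl sqr_ge0.
rewrite (le_trans (ler_norm_sum _ _ _))//.
apply: (@le_trans _ _ (\sum_(c <- s | ~~ anchored r r' c)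
  (lo c <= r < hi c)%N%:R * (eta + eta))).
  rewrite big_seq_cond [leRHS]big_seq_cond; apply: ler_sum => c /andP[cs cm].
  rewrite normrM -[leRHS]mul1r ler_pM//; first exact: (allP ws c cs).
  exact: almost_block_unanchored vb cm.
rewrite -mulr_suml ler_piMl ?addr_ge0//.
apply: le_trans (successive_sum_le r ss).
rewrite big_mkcond [leRHS]big_mkcond/=; apply: ler_sum => c _.
by case: ifP; case: ifP; rewrite ?ler01.
Qed.

Lemma interval_count (r : nat -> nat) a N :
  (forall k, (r k <= r k.+1)%N) ->
  (\sum_(k < N) (r k <= a < r k.+1) <= 1)%N.
Proof.
move=> rr; have : (\sum_(k < N) (r k <= a < r k.+1) <= (a < r N))%N.
  elim: N => [|N IH]; first by rewrite big_ord0.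
  rewrite big_ord_recr/=; move: IH (rr N); set S := (\sum_(_ < _) _)%N.
  by case: (ltnP a (r N)) => ?; case: (ltnP a (r N.+1)) => ? /=; lia.
by move=> /leq_trans; apply; case: ltnP.
Qed.

(** A piece is anchored in at most three blocks of a successive family, one for
    its coordinate and one for each end of its interval. *)
Lemma anchored_energy (r : nat -> nat) N (s : seq (@piece R)) :
  (forall k, (r k <= r k.+1)%N) ->
  \sum_(k < N) energy [seq c <- s | anchored (r k) (r k.+1) c] <= 3 * energy s.
Proof.
move=> rr; rewrite /energy.
under eq_bigr do rewrite big_filter big_mkcond/=.
rewrite exchange_big mulr_sumr/=; apply: ler_sum => c _.
apply: (@le_trans _ _ (\sum_(k < N)
  ((r k <= crd c < r k.+1) + (r k <= lo c < r k.+1) + (r k <= hi c < r k.+1))%N%:R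
   * wt c ^+ 2)).
  apply: ler_sum => k _; have := sqr_ge0 (wt c).
  rewrite /anchored; case: ifPn => [H|_] w0; last by rewrite mulr_ge0.
  rewrite -[leLHS]mul1r ler_wpM2r// ler1n.
  by move: H; do 3 case: (_ <= _ < _)%N.
rewrite -mulr_suml ler_wpM2r ?sqr_ge0// -natr_sum ler_nat 2!big_split/=.
by rewrite (leq_add (leq_add (interval_count _ _ rr) (interval_count _ _ rr))
  (interval_count _ _ rr)).
Qed.

(** For [N = K^2] blocks, [almost_block_pairing] with [t = K = sqrt N] bounds the
    sum by [(3 K + K) / 2 + 3 N eta], the last term being at most [3/4]. *)
Lemma almost_blocks_norm eta (r : nat -> nat) (v : nat -> JL R) K :
  (0 < K)%N -> 0 <= eta -> 4 * (K%:R ^+ 2 * eta) <= 1 ->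
  (forall k, almost_block eta (r k) (r k.+1) (v k)) ->
  `|\sum_(k < K ^ 2) v k| <= 3 * K%:R.
Proof.
move=> K0 eta0 Keta vb; apply: JL_norm_le => s Ks.
have rr k : (r k <= r k.+1)%N by case: (vb k) => /ltnW.
have K0R : (0 : R) < K%:R by rewrite ltr0n.
have K1 : (1 : R) <= K%:R by rewrite ler1n.
rewrite pairing_sum (le_trans (ler_norm_sum _ _ _))//.
apply: (@le_trans _ _ (\sum_(k < K ^ 2)
  ((K%:R * energy [seq c <- s | anchored (r k) (r k.+1) c] + K%:R^-1) / 2
     + 3 * eta))).
  by apply: ler_sum => k _; exact: almost_block_pairing.
rewrite big_split/= -mulr_suml big_split/= -mulr_sumr !sumr_const card_ord.
rewrite -[K%:R^-1 *+ _]mulr_natl -[3 * eta *+ _]mulr_natl natrX.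
have -> : K%:R ^+ 2 * K%:R^-1 = K%:R :> R by rewrite expr2 mulfK ?gt_eqF.
have := @anchored_energy r (K ^ 2) s rr; set S := \sum_(_ < _) _ => SE.
have S3 : S <= 3 by apply: le_trans SE _; rewrite ler_piMr//; case: Ks.
have KS : K%:R * S <= K%:R * 3 by rewrite ler_pM2l.
rewrite [_ * (3 * eta)]mulrCA.
lra.
Qed.

End upper_estimate.

(** * Dual spaces and the weak-star topology *)

Lemma cvg_seq_comp (T U : topologicalType) (f : T -> U) (u : nat -> T) l :
  continuous f -> u @ \oo --> l -> f (u n) @[n --> \oo] --> f l.
Proof. by move=> cf ul; apply: (continuous_cvg _ (cf l) ul). Qed.

Section dual_space.
Context {R : realType}.
Implicit Types (X Z : normedModType R).

Lemma dual_le X (f : dual X) x : `|f x| <= `|f| * `|x|.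
Proof.
have [->|x0] := eqVneq x 0; first by rewrite dual_at0 !normr0 mulr0.
rewrite -ler_pdivrMr ?normr_gt0//.
have -> : `|f x| / `|x| = `|f (`|x|^-1 *: x)|.
  by rewrite dual_atZ normrM normfV normr_id mulrC.
rewrite dual_normE; apply: sup_norm_ub; first exact: dual_bounded.
by rewrite /unit_ball/= normrZ normfV normr_id mulVf// normr_eq0.
Qed.

Lemma dual_norm_le X (f : dual X) (C : R) : 0 <= C ->
  (forall x, `|f x| <= C * `|x|) -> `|f| <= C.
Proof.
move=> C0 fC; rewrite dual_normE; apply: sup_norm_le => [|x x1].
  exact: unit_ball_neq0.
by rewrite (le_trans (fC x))// ler_piMr.
Qed.

Lemma dual_exists X (f : X -> R) (C : R) : scalar f ->
  (forall x, `|f x| <= C * `|x|) -> exists g : dual X, g =1 f.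
Proof.
move=> lf fC; have fD : f \in @dual_pred R X.
  by apply/asboolP; split=> //; exact: scalar_bounded_continuous fC.
by exists (Dual fD).
Qed.

Lemma dualB X (f : dual X) x y : f (x - y) = f x - f y.
Proof. by rewrite addrC -scaleN1r dual_scalar mulN1r addrC. Qed.

Lemma dual_atD X (f : dual X) x y : f (x + y) = f x + f y.
Proof. by rewrite -[x]scale1r dual_scalar mul1r scale1r. Qed.

Lemma dual_at_sum X (f : dual X) n (v : nat -> X) :
  f (\sum_(k < n) v k) = \sum_(k < n) f (v k).
Proof.
elim/big_ind2 : _ => [|x a y b xa yb|//]; first exact: dual_at0.
by rewrite dual_atD xa yb.
Qed.

Lemma weak_star_eval_continuous X x :
  continuous ((fun f => f x) : weak_star X -> R).
Proof.
move=> f.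
apply: (@continuous_comp (weak_star X) {ptws X -> R} R
  (fun f : dual X => (f : X -> R)) (fun h => h x)).
  exact: initial_continuous.
exact: (@proj_continuous _ (fun=> R) x).
Qed.

Lemma continuous_into_weak_star X (T : topologicalType) (F : T -> dual X) :
  (forall x, continuous (fun t => F t x : R)) ->
  continuous (F : T -> weak_star X).
Proof.
move=> Fx; apply: continuous_comp_initial => t.
by apply/pointwise_cvgP => x; exact: Fx.
Qed.

End dual_space.

(** * The unit ball of [ell_1] maps onto the unit ball of [c_0] *)

Section lifting.
Context {R : realType}.
Implicit Types (x : JL R) (i m n : nat).

Definition l1unit : set (JL R) := [set x | l1ball x].

Lemma l1unit_norm x : l1unit x -> `|x| <= 1.
Proof.
move=> x1; apply: JL_norm_le => s [ss /energy_wt_le1 s1].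
exact: pairing_l1ball.
Qed.

Lemma JL_coord_continuous i : continuous (fun x : JL R => x i).
Proof.
apply: (@scalar_bounded_continuous _ _ _ 1) => // x.
by rewrite mul1r JL_coord_le.
Qed.

Lemma closed_l1unit : closed l1unit.
Proof.
have -> : l1unit = \bigcap_n [set x : JL R | \sum_(0 <= i < n) `|x i| <= 1].
  by apply/seteqP; split=> [x xW n _|x xW n]; [exact: xW|exact: (xW n I)].
apply: closed_bigI => n _.
apply: (@closed_comp _ _ (fun x : JL R => \sum_(0 <= i < n) `|x i|)
  [set a | a <= 1]) => [x _|]; last exact: closed_le.
move: x; apply: continuous_big => [|i _ x]; first exact: add_continuous.
by apply: (continuous_comp (@JL_coord_continuous i x)); exact: norm_continuous.
Qed.

Lemma qcoord_continuous m : continuous (@qcoord R m).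
Proof.
apply: (@scalar_bounded_continuous _ _ _ 1) => [|x]; first exact: qcoord_scalar.
by rewrite mul1r qcoord_le.
Qed.

Definition unit_seq i : nat -> R := fun j => (j == i)%:R.

Lemma sum_delta (F : nat -> R) i n :
  \sum_(0 <= j < n) (j == i)%:R * F j = (i < n)%N%:R * F i.
Proof.
case: ltnP => [lt|ge] /=.
  rewrite mul1r (bigD1_seq i)/= ?mem_index_iota ?iota_uniq// eqxx mul1r.
  by rewrite big1 ?addr0// => j /negPf ->; rewrite mul0r.
rewrite mul0r big_nat big1// => j /= jn; rewrite (_ : j == i = false) ?mul0r//.
lia.
Qed.

Lemma sum_delta_le1 i n : \sum_(0 <= j < n) ((j == i)%:R : R) <= 1.
Proof.
under eq_bigr do rewrite -[_%:R]mulr1.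
by rewrite (sum_delta (fun=> 1)) mulr1; case: ltnP.
Qed.

Lemma unit_seq_l1ball i : l1ball (unit_seq i).
Proof.
by move=> n; under eq_bigr do rewrite /unit_seq ger0_norm//; exact: sum_delta_le1.
Qed.

Definition unit_vec i : JL R := MkJL (l1ball_JL (unit_seq_l1ball i)).

Lemma qcoord_unit_vec m i : qcoord m (unit_vec i) = sgnv i m.
Proof.
apply: cvg_lim => //; apply/cvgrPdist_le => e e0; exists i.+1 => // n /= ni.
by rewrite /segsum sum_delta ni mul1r subrr normr0 ltW.
Qed.

Lemma sum_half_pows n : \sum_(0 <= k < n) (2 : R)^-1 ^+ k.+1 = 1 - 2^-1 ^+ n.
Proof.
elim: n => [|n IH]; first by rewrite big_nil expr0 subrr.
by rewrite big_nat_recr//= IH exprS; lra.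
Qed.

(** Iterating [sgnv_halving]: if [u] has norm at most 1, so does the remainder
    [w = 2 u - z], and [u = z/2 + w/2].  The indices can be taken beyond any [n],
    since every sign vector occurs there. *)
Lemma quot_lift n (u : c0 R) : `|u| <= 1 ->
  exists x, [/\ l1unit x, forall i, (i < n)%N -> x i = 0 & quot x = u].
Proof.
move=> u1.
(* [iw] is made of the index of a sign vector and of the next remainder; the bound
   on [v] is a premise inside the existential so that [choice] gives a total map *)
have halve (v : c0 R) : exists iw : nat * c0 R, `|v| <= 1 ->
    [/\ (n <= iw.1)%N, `|iw.2| <= 1 &
      forall m, v m = 2^-1 * sgnv iw.1 m + 2^-1 * iw.2 m].
  have [v1|] := boolP (`|v| <= 1); last by exists (0%N, 0).
  have [|i ni vi] := @sgnv_halving R v n.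
    by move=> m; exact: le_trans (c0_coord_le _ _) v1.
  pose w := 2 *: v - quot (unit_vec i).
  have wE m : w m = 2 * v m - sgnv i m by rewrite -qcoord_unit_vec.
  have w1 : `|w| <= 1.
    apply: c0_norm_le => m; have := vi m; rewrite wE !ler_norml.
    by move=> /andP[? ?]; apply/andP; split; lra.
  by exists (i, w) => _; split=> // m; rewrite [(i, w).2 m]wE/=; lra.
have {halve}[F halve] := choice halve.
pose rem k := iter k (fun v => (F v).2) u.
pose idx k := (F (rem k)).1.
have rem1 k : `|rem k| <= 1.
  by elim: k => [//|k IH]; have [] := halve _ IH.
pose t k := 2^-1 ^+ k.+1 *: unit_vec (idx k).
have tE N i : series t N i = \sum_(0 <= k < N) 2^-1 ^+ k.+1 * (i == idx k)%:R.
  rewrite /series/=; elim: N => [|N IH]; first by rewrite !big_nil.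
  by rewrite !big_nat_recr//= -IH.
have qtE N m : qcoord m (series t N) = u m - 2^-1 ^+ N * rem N m.
  elim: N => [|N IH].
    by rewrite /series/= big_nil mul1r subrr linear0.
  rewrite seriesSr addrC qcoord_scalar IH qcoord_unit_vec.
  have [_ _ ->] := halve _ (rem1 N).
  by rewrite exprSr; rewrite -/(idx N) /rem/=; lra.
have ct : cvgn (series t).
  apply: normed_cvg; apply: (@series_le_cvg _ _ (geometric 2^-1 2^-1)) => k.
  - exact: normr_ge0.
  - by rewrite /geometric/= mulr_ge0 ?exprn_ge0.
  - rewrite /geometric/= /t normrZ -exprS ger0_norm ?exprn_ge0//.
    by rewrite ler_piMr ?exprn_ge0// l1unit_norm//; exact: unit_seq_l1ball.
  - by apply: is_cvg_geometric_series; rewrite ger0_norm ?invf_lt1 ?ltr1n.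
have pow0 : (fun N => 2^-1 ^+ N : R) @ \oo --> (0 : R).
  by apply: cvg_expr; rewrite ger0_norm ?invf_lt1 ?ltr1n.
exists (limn (series t)); split.
- apply: (closed_cvg l1unit closed_l1unit _ _ ct).
  near=> N => M.
  apply: (@le_trans _ _ (\sum_(0 <= i < M) \sum_(0 <= k < N)
      2^-1 ^+ k.+1 * (i == idx k)%:R)).
    apply: ler_sum => i _; rewrite tE ger0_norm//; apply: sumr_ge0 => k _.
    by rewrite mulr_ge0 ?exprn_ge0.
  rewrite exchange_big/=.
  apply: (@le_trans _ _ (\sum_(0 <= k < N) 2^-1 ^+ k.+1)).
    apply: ler_sum => k _; rewrite -mulr_sumr ler_piMr ?exprn_ge0//.
    exact: sum_delta_le1.
  by rewrite sum_half_pows gerBl exprn_ge0.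
- move=> i ni; have : series t N i @[N --> \oo] --> limn (series t) i.
    exact: (cvg_seq_comp (@JL_coord_continuous i) ct).
  move=> /cvg_lim <- //; apply: cvg_lim => //.
  rewrite (_ : (fun N => _) = fun=> 0); first exact: cvg_cst.
  apply/funext => N; rewrite tE big1// => k _.
  have [nk _ _] := halve _ (rem1 k).
  by rewrite (_ : (i == idx k) = false) ?mulr0// /idx; lia.
- apply/val_inj/funext => m /=.
  have : qcoord m (series t N) @[N --> \oo] --> qcoord m (limn (series t)).
    exact: (cvg_seq_comp (@qcoord_continuous m) ct).
  move=> /cvg_lim <- //; apply: cvg_lim => //.
  rewrite (_ : (fun N => _) = fun N => u m - 2^-1 ^+ N * rem N m); last first.
    by apply/funext => N; exact: qtE.
  rewrite -[X in _ --> X]subr0; apply: cvgB; first exact: cvg_cst.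
  apply/cvgrPdist_le => e e0; move/cvgrPdist_le: pow0 => /(_ e e0).
  apply: filterS => N; rewrite !sub0r !normrN normrM => Ne.
  rewrite (le_trans _ Ne)// ler_piMr//.
  exact: le_trans (c0_coord_le _ _) (rem1 N).
Unshelve. all: by end_near. Qed.

Lemma quot_lift_norm (u : c0 R) : exists x, `|x| <= `|u| /\ quot x = u.
Proof.
have [->|u0] := eqVneq u 0; first by exists 0; rewrite !normr0 linear0.
have [|x [x1 _ xu]] := @quot_lift 0 (`|u|^-1 *: u).
  by rewrite normrZ normfV normr_id mulVf// normr_eq0.
exists (`|u| *: x); split.
  by rewrite normrZ normr_id ler_piMr// l1unit_norm.
by rewrite linearZ/= xu scalerA divff ?scale1r// normr_eq0.
Qed.

End lifting.

(** * The adjoint embedding of the dual of [c_0] *)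

Section adjoint.
Context {R : realType}.
Implicit Types (x : JL R) (g : dual (c0 R)) (f : dual (JL R)).

Lemma adjoint_subproof g : (fun x => g (quot x)) \in @dual_pred R (JL R).
Proof.
apply/asboolP; split=> [a x y|]; first by rewrite linearP dual_scalar.
apply: (@scalar_bounded_continuous _ _ _ `|g|) => [a x y|x].
  by rewrite linearP dual_scalar.
by rewrite (le_trans (dual_le _ _))// ler_wpM2l// quot_le.
Qed.

Definition adjoint g : dual (JL R) := Dual (adjoint_subproof g).

Lemma adjoint_linear : linear adjoint.
Proof. by move=> a g h; apply/val_inj/funext. Qed.

HB.instance Definition _ :=
  GRing.isLinear.Build R (dual (c0 R)) (dual (JL R)) _ adjoint adjoint_linear.

Lemma adjoint_norm_le_l1 g (C : R) : 0 <= C ->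
  (forall x, l1unit x -> `|adjoint g x| <= C) -> `|g| <= C.
Proof.
move=> C0 gC; rewrite dual_normE; apply: sup_norm_le => [|u u1].
  exact: unit_ball_neq0.
by have [x [x1 _ <-]] := quot_lift 0 u1; exact: gC.
Qed.

Lemma adjoint_norm g : `|adjoint g| = `|g|.
Proof.
apply/eqP; rewrite eq_le; apply/andP; split.
  apply: dual_norm_le => // x; apply: le_trans (dual_le g (quot x)) _.
  by rewrite ler_wpM2l// quot_le.
apply: adjoint_norm_le_l1 => // x x1.
by rewrite (le_trans (dual_le _ _))// ler_piMr// l1unit_norm.
Qed.

Lemma adjoint_inj : injective adjoint.
Proof.
move=> g h gh; apply/eqP; rewrite -subr_eq0 -normr_eq0 -adjoint_norm linearB/=.
by rewrite gh subrr normr0.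
Qed.

(** A functional that vanishes on the kernel of the quotient map factors through
    any choice of preimages; norm-preserving preimages make the factor bounded. *)
Lemma range_adjointE :
  range adjoint = [set f | forall x, quot x = 0 -> f x = 0].
Proof.
apply/seteqP; split=> [_ [g _ <-] x /= ->|f f0]; first exact: dual_at0.
have [L HL] := choice (@quot_lift_norm R).
have fL x : f (L (quot x)) = f x.
  apply/eqP; rewrite -subr_eq0 -dualB f0// linearB/=.
  by rewrite (HL (quot x)).2 subrr.
have [|u|g gE] := @dual_exists _ (c0 R) (fun u => f (L u)) `|f|.
- by move=> a u v; rewrite -dual_scalar -[RHS]fL linearP/= (HL u).2 (HL v).2.
- by rewrite (le_trans (dual_le _ _))// ler_wpM2l// (HL u).1.
- by exists g => //; apply/val_inj/funext => x /=; rewrite gE fL.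
Qed.

Lemma dual_eval_continuous x : continuous (fun f => f x).
Proof.
apply: (@scalar_bounded_continuous _ _ _ `|x|) => // f.
by rewrite mulrC dual_le.
Qed.

(** As an annihilator, the range is an intersection of kernels of evaluations. *)
Lemma closed_subspace_range_adjoint : closed_subspace (range adjoint).
Proof.
split.
  split; first by rewrite inE; exists 0 => //; exact: linear0.
  move=> a f h; rewrite !inE => -[f' _ <-] [h' _ <-].
  by exists (a *: f' + h') => //; exact: linearP.
rewrite range_adjointE.
rewrite [X in closed X](_ : _ =
    \bigcap_(x in [set x : JL R | quot x = 0]) [set f : dual (JL R) | f x = 0]).
  apply: closed_bigI => x _.
  apply: (@closed_comp _ _ (fun f : dual (JL R) => f x) [set a | a = 0]).
    by move=> f _; exact: dual_eval_continuous.
  exact: closed_eq.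
by apply/seteqP; split=> f Hf x; exact: Hf.
Qed.

(** The inverse is continuous because evaluating the preimage of [f] at [u] is
    evaluating [f] at any vector that the quotient map sends to [u]. *)
Lemma adjoint_isomorphism :
  isometric_weak_star_isomorphic (c0 R) (range adjoint).
Proof.
pose S f : dual (c0 R) := xget 0 [set g | adjoint g = f].
have SK : cancel adjoint S.
  move=> g; apply: adjoint_inj.
  exact: (@xgetPex _ 0 [set h | adjoint h = adjoint g] (ex_intro _ g erefl)).
exists adjoint, S; split=> //; first exact: adjoint_norm.
  apply: continuous_into_weak_star => x.
  exact: (@weak_star_eval_continuous _ (c0 R) (quot x)).
apply: continuous_into_weak_star => u.
have [x [_ xu]] := quot_lift_norm u.
apply: (@subspace_eq_continuous (weak_star (JL R)) (range adjoint) R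
  (fun f : dual (JL R) => f x)); last first.
  by apply: continuous_subspaceT; exact: weak_star_eval_continuous.
move=> f; rewrite inE => -[g _ <-]; rewrite /= xu.
exact: (esym (congr1 (fun h : dual (c0 R) => h u) (SK g))).
Qed.

Lemma l1unit_norming : norming 2^-1 l1unit (range adjoint).
Proof.
move=> _ [g _ <-]; rewrite adjoint_norm.
have ub : has_ubound [set `|adjoint g w| | w in l1unit].
  exists `|adjoint g| => _ [x x1 <-]; apply: le_trans (dual_le _ _) _.
  by rewrite ler_piMr// l1unit_norm.
apply: (@le_trans _ _ `|g|); first by rewrite ler_piMl// invf_le1// ler1n.
apply: adjoint_norm_le_l1 => [|x x1].
  have /le_trans : 0 <= `|adjoint g (unit_vec 0) : R| by []; apply.
  by apply: ub_le_sup => //; exists (unit_vec 0) => //; exact: unit_seq_l1ball.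
by apply: ub_le_sup => //; exists x.
Qed.

Lemma bounded_l1unit : bounded_set (@l1unit R).
Proof.
exists 1; split=> // M M1 x x1.
exact: le_trans (l1unit_norm x1) (ltW M1).
Qed.

Lemma symmetric_l1unit : symmetric_set (@l1unit R).
Proof. by move=> x x1 n; under eq_bigr do rewrite normrN; exact: x1. Qed.

Lemma convex_l1unit : convex_set (@l1unit R).
Proof.
have combination c x y : 0 <= c -> c <= 1 -> l1unit x -> l1unit y ->
    l1unit (c *: x + (1 - c) *: y).
  move=> c0 c1 x1 y1 n.
  apply: (@le_trans _ _ (c * \sum_(0 <= i < n) `|x i| +
      (1 - c) * \sum_(0 <= i < n) `|y i|)).
    rewrite !mulr_sumr -big_split; apply: ler_sum => i _ /=.
    rewrite (le_trans (ler_normD _ _))//= !normrM.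
    by rewrite (ger0_norm c0) (@ger0_norm _ (1 - c)) ?subr_ge0.
  rewrite [leRHS](_ : _ = c * 1 + (1 - c) * 1); last by ring.
  by rewrite lerD// ler_wpM2l// subr_ge0.
by move=> x y k; rewrite !inE => x1 y1; exact: combination.
Qed.

End adjoint.

(** * Thinness *)

Section subspaces.
Context {R : realType} {X : normedModType R}.
Implicit Types (V : set X).

Lemma submod_in V : submod_closed [in V] ->
  V 0 /\ forall a x y, V x -> V y -> V (a *: x + y).
Proof.
move=> [V0 VD]; split=> [|a x y Vx Vy]; apply: set_mem => //.
by apply: VD; exact: mem_set.
Qed.

Lemma submod_sum V n (v : nat -> X) : submod_closed [in V] ->
  (forall k, V (v k)) -> V (\sum_(k < n) v k).
Proof.
move=> /submod_in[V0 VD] Vv; elim/big_ind : _ => [//|x y Vx Vy|k _]; last exact: Vv.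
by rewrite -[x]scale1r; exact: VD.
Qed.

(** By induction on the number of forms: the kernel of one form has codimension at
    most one in [V]. *)
Lemma finite_dimensional_kernels V (phi : nat -> X -> R) N :
  submod_closed [in V] -> (forall j, scalar (phi j)) ->
  (forall v, V v -> (forall j, (j < N)%N -> phi j v = 0) -> v = 0) ->
  finite_dimensional V.
Proof.
move=> + lphi; elim: N V => [|N IH] V sV V0.
  have [V00 _] := submod_in sV; exists 0%N, (fun=> 0).
  apply/seteqP; split=> [v Vv|_ [a _ <-]]; last by rewrite big_ord0.
  by exists (fun=> 0) => //; rewrite big_ord0 (V0 v).
have [VV0 VD] := submod_in sV.
have phi0 : phi N 0 = 0.
  have := lphi N (-1) 0 0; rewrite scaler0 addr0 mulN1r => ->.
  by rewrite addNr.
have [||n [e Ve]] := IH (V `&` [set v | phi N v = 0]).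
- split; first by apply: mem_set; split.
  move=> a x y /set_mem[Vx x0] /set_mem[Vy y0]; apply: mem_set.
  by split; [exact: VD|rewrite /= lphi x0 y0 mulr0 addr0].
- move=> v [Vv vN] vj; apply: V0 => // j; rewrite ltnS leq_eqVlt.
  by move=> /predU1P[->//|]; exact: vj.
have [Vker|/existsNP[x0 /not_implyP[Vx0 /eqP x00]]] :=
  pselect (forall v, V v -> phi N v = 0).
  exists n, e; rewrite -Ve; apply/seteqP; split=> v; last by case.
  by move=> Vv; split=> //; exact: Vker.
pose ext (T : Type) (f : 'I_n -> T) (t : T) (i : 'I_n.+1) :=
  oapp f t (unlift ord_max i).
have extE (a : 'I_n -> R) t :
    \sum_(i < n.+1) ext _ a t i *: ext _ e x0 i =
    \sum_(i < n) a i *: e i + t *: x0.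
  rewrite big_ord_recr/= /ext unlift_none/=; congr (_ + _).
  apply: eq_bigr => i _.
  have -> : widen_ord (leqnSn n) i = lift ord_max i.
    by apply: val_inj; rewrite /= /bump leqNgt ltn_ord.
  by rewrite !liftK.
exists n.+1, (ext _ e x0); apply/seteqP; split=> [v Vv|_ [b _ <-]].
  pose t := phi N v / phi N x0.
  have : (V `&` [set v | phi N v = 0]) (- t *: x0 + v).
    split; first exact: VD.
    by rewrite /= lphi /t mulNr divfK// addNr.
  rewrite Ve => -[a _ av]; exists (ext _ a t) => //.
  by rewrite extE av addrAC scaleNr addNr add0r.
pose a i := b (lift ord_max i).
have -> : b = ext _ a (b ord_max).
  by apply/funext => i; rewrite /ext; case: unliftP => [j ->|->].
rewrite extE addrC; apply: VD => //.
suff [] : (V `&` [set v | phi N v = 0]) (\sum_(i < n) a i *: e i) by [].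
by rewrite Ve; exists a.
Qed.

End subspaces.

Section thinness.
Context {R : realType}.
Implicit Types (x v : JL R) (V : set (JL R)).

Lemma infinite_dimensional_tail V r : submod_closed [in V] ->
  ~ finite_dimensional V ->
  exists v, [/\ V v, `|v| = 1, forall i, (i < r)%N -> v i = 0 &
    forall m, (m < r)%N -> qcoord m v = 0].
Proof.
move=> sV infV; apply: contrapT => none; apply: infV.
pose phi j (x : JL R) : R := if odd j then qcoord j./2 x else x j./2.
apply: (@finite_dimensional_kernels _ _ _ phi r.*2 sV) => [j a x y|v Vv v0].
  by rewrite /phi; case: odd => //; exact: qcoord_scalar.
apply/eqP/negPn/negP => vn0; apply: none.
have [V0 VD] := submod_in sV.
exists (`|v|^-1 *: v); split.
- by rewrite -[_ *: v]addr0; exact: VD.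
- by rewrite normrZ normfV normr_id mulVf// normr_eq0.
- move=> i ir; have := v0 i.*2; rewrite /phi odd_double doubleK ltn_double.
  by move=> /(_ ir) vi; rewrite -[_ *: v]addr0 JL_coord_linear vi mulr0 add0r.
- move=> m mr; have := v0 m.*2.+1.
  rewrite /phi/= odd_double/= uphalf_double -doubleS.
  by rewrite ltn_Sdouble => /(_ mr) vm; rewrite linearZ/= vm mulr0.
Qed.

(** The constant [1/24] comes out as follows.  With [N = K^2] blocks,
    [x = (sum_k v_k) / (3 K)] is in the unit ball of [V], and the sum [S] of the
    functionals norming the [v_k] satisfies [S x >= (N / 4) / (3 K) = K / 12].  On
    the other hand [S] is at most 1 on the unit ball of [ell_1] and at most [K] on
    the unit ball of the space.  So [x = lambda w + b / 24] would give
    [K / 12 <= lambda + K / 24], which fails as soon as [K > 24 lambda]. *)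
Lemma thin_l1unit : thin (@l1unit R).
Proof.
split.
- by exists (unit_vec 0); exact: unit_seq_l1ball.
- exact: bounded_l1unit.
- exact: convex_l1unit.
- exact: symmetric_l1unit.
move=> V [sV _] infV; exists 24^-1; first by rewrite invr_gt0.
move=> lambda lambda0 absorb.
pose K := (Num.truncn (24 * lambda)).+1.
have Klambda : 24 * lambda < K%:R by rewrite truncnS_gt.
have K0 : (0 : R) < K%:R by rewrite ltr0n.
pose N := (K ^ 2)%N.
pose eta : R := (4 * K%:R ^+ 2)^-1.
have eta0 : 0 < eta by rewrite invr_gt0 mulr_gt0// exprn_gt0.
have Neta : N%:R * eta = 4^-1.
  by rewrite /eta /N natrX; field; rewrite gt_eqF.
(* one block of [V] starting at [r], where it stops, and a functional norming it *)
have step r : exists F : JL R * nat * seq (@piece R),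
    [/\ V F.1.1, almost_block eta r F.1.2 F.1.1,
      admissible F.2 /\ 2^-1 < pairing F.2 F.1.1,
      all (fun c => (r <= lo c)%N) F.2 & all (fun c => (hi c <= F.1.2)%N) F.2].
  have [v [Vv v1 vr vm]] := infinite_dimensional_tail r sV infV.
  have [|r0 vb] := almost_block_exists eta0 _ vr vm; first by rewrite v1.
  have [|s [[ss se] sv]] := @JL_exists_functional _ v 2^-1.
    by rewrite v1 invf_lt1// ltr1n.
  have [M sM] := hi_bounded s.
  exists (v, maxn r0 M, cut_below r s); split=> //=.
  - by apply: vb; exact: leq_maxl.
  - split; first by split; [exact: successive_cut_below|rewrite energy_cut_below].
    have := sv; rewrite (pairing_cut r) [X in X + _](@pairing_eq0 _ _ _ r) ?add0r//.
    by rewrite all_map; apply/allP => c _; exact: geq_minr.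
  - exact: cut_below_lo.
  - rewrite all_map; apply: sub_all sM => c /= cM.
    exact: leq_trans cM (leq_maxr _ _).
have {step}[F stepF] := choice step.
pose r k := iter k (fun r => (F r).1.2) 0%N.
pose v k := (F (r k)).1.1.
have Vv k : V (v k) by have [] := stepF (r k).
have vb k : almost_block eta (r k) (r k.+1) (v k) by have [] := stepF (r k).
have rr k l : (k <= l)%N -> (r k <= r l)%N.
  move/subnK <-; elim: (l - k)%N => [//|d IH]; rewrite addSn.
  by apply: leq_trans IH _; case: (vb (d + k)%N) => /ltnW.
have vN : `|\sum_(k < N) v k| <= 3 * K%:R.
  apply: (almost_blocks_norm _ (ltW eta0) _ vb) => //.
  by rewrite -natrX -/N Neta mulfV.
(* a later functional is at most [eta] on an earlier block, an earlier functional
   vanishes on a later block *)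
have build j : exists S : seq (@piece R),
    [/\ successive S /\ energy S <= j%:R, all (fun c => `|wt c| <= 1) S,
      all (fun c => (hi c <= r j)%N) S &
      forall l, (l < j)%N -> 2^-1 - j%:R * eta <= pairing S (v l)].
  elim: j => [|j [S [[Ss Se] Sw Sr Sv]]].
    by exists [::]; split=> //; split=> //; rewrite /energy big_nil.
  have [_ _ [[ss se] sv] slo shi] := stepF (r j).
  exists (S ++ (F (r j)).2); split.
  - split; first exact: successive_cat Sr slo.
    by rewrite energy_cat -[j.+1%:R]natr1 lerD.
  - by rewrite all_cat Sw energy_wt_le1.
  - rewrite all_cat shi andbT; apply: sub_all Sr => c /= cr.
    exact: leq_trans cr (rr _ _ (leqnSn j)).
  - move=> l; rewrite ltnS leq_eqVlt pairing_cat -[j.+1%:R]natr1 mulrDl mul1r.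
    move=> /predU1P[->|lj].
      rewrite (@pairing_eq0 _ _ _ (r j))// ?add0r; last by case: (vb j).
      apply: le_trans (ltW sv); rewrite gerBl addr_ge0 ?(ltW eta0)//.
      by rewrite mulr_ge0// ltW.
    rewrite opprD addrA lerD ?Sv//.
    have [_ _ _ /(_ (F (r j)).2) vt _] := vb l.
    suff : `|pairing (F (r j)).2 (v l)| <= eta by rewrite ler_norml => /andP[].
    apply: vt => //; apply: sub_all slo => c /= cj.
    exact: leq_trans (rr _ _ lj) cj.
have {build}[S [[Ss Se] Sw _ Sv]] := build N.
have [V0 VD] := submod_in sV.
pose x := (3 * K%:R)^-1 *: \sum_(k < N) v k.
have Vx : V x by rewrite /x -[_ *: _]addr0; apply: VD => //; exact: submod_sum.
have x1 : `|x| <= 1.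
  have K3 : 0 < 3 * K%:R :> R by rewrite mulr_gt0.
  by rewrite /x normrZ gtr0_norm ?invr_gt0// ler_pdivrMl// mulr1.
have xS : K%:R / 12 <= pairing S x.
  rewrite pairingZ pairing_sum ler_pdivlMl ?mulr_gt0//.
  apply: (@le_trans _ _ (\sum_(k < N) 4^-1)).
    rewrite sumr_const card_ord -[4^-1 *+ _]mulr_natl /N natrX.
    by rewrite le_eqVlt; apply/orP; left; apply/eqP; field.
  apply: ler_sum => k _; apply: le_trans (Sv k (ltn_ord k)).
  by rewrite Neta; lra.
have [//|w w1 [b b1 wb]] := absorb x.
have : `|pairing S w| <= 1 by apply: pairing_l1ball.
have : `|pairing S b| <= K%:R.
  rewrite -[leRHS]mulr1; apply: le_trans (ler_wpM2l (ltW K0) b1).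
  by apply: pairing_le => //; rewrite -natrX -/N.
rewrite !ler_norml => /andP[_ Sb] /andP[_ Sw1].
move: xS; rewrite -wb pairingD !pairingZ => xS.
have : lambda * pairing S w <= lambda * 1 by rewrite ler_pM2l.
lra.
Qed.

End thinness.

(** * Separability of the dual *)

Section separability.
Context {R : realType}.

Lemma separable_span (E : normedModType R) (I : countType) (phi : I -> E) :
  (forall f e, 0 < e -> exists s : seq (R * I),
    `|f - \sum_(p <- s) p.1 *: phi p.2| <= e) ->
  separable E.
Proof.
move=> approx.
pose comb (t : seq (rat * I)) := \sum_(p <- t) ratr p.1 *: phi p.2 : E.
exists (range comb).
  by apply: card_le_trans (card_image_le _ _) _; exact: countableP.
have rational s e : 0 < e -> exists t, `|\sum_(p <- s) p.1 *: phi p.2 - comb t| <= e.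
  elim: s e => [|[a i] s IH] e e0.
    by exists [::]; rewrite /comb !big_nil subrr normr0 ltW.
  have [t st] := IH (e / 2) (divr_gt0 e0 (ltr0Sn R 1)).
  have d0 : 0 < e / 2 / (`|phi i| + 1).
    by rewrite !divr_gt0// ltr_wpDl.
  have [q] : exists q, ratr q \in `](a : R), a + e / 2 / (`|phi i| + 1)[.
    by apply: rat_in_itvoo; rewrite ltrDl.
  rewrite in_itv/= => /andP[aq qa]; exists ((q, i) :: t).
  rewrite /comb !big_cons/= opprD addrACA -scalerBl [e]splitr.
  rewrite (le_trans (ler_normD _ _))// lerD// normrZ distrC gtr0_norm ?subr_gt0//.
  rewrite (@le_trans _ _ (e / 2 / (`|phi i| + 1) * (`|phi i| + 1)))//.
    by rewrite ler_pM// ?subr_ge0 ?ltW// ?ltrBlDl// ltrDl.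
  by rewrite divfK// gt_eqF// ltr_wpDl.
move=> O [f Of] Oo.
have /nbhs_ballP[e /= e0 fO] : nbhs f O by exact: open_nbhs_nbhs.
have e40 : 0 < e / 4 by rewrite divr_gt0.
have [s fs] := approx f _ e40; have [t st] := rational s _ e40.
exists (comb t); split; last by exists t.
apply: fO; rewrite -ball_normE/= -(subrKA (\sum_(p <- s) p.1 *: phi p.2)).
by rewrite (le_lt_trans (ler_normD _ _))// (le_lt_trans (lerD fs st))//; lra.
Qed.

Lemma c0_finite (a : nat -> R) n : (forall m, (n <= m)%N -> a m = 0) ->
  a \in @c0_pred R.
Proof.
move=> an; apply/asboolP/cvgrPdist_le => e e0; exists n => // m /= nm.
by rewrite an// subrr normr0 ltW.
Qed.

Implicit Types (x v : JL R) (f : dual (JL R)) (i m n : nat).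

Definition tail_kernel n : set (JL R) := [set v : JL R |
  (forall i, (i < n)%N -> v i = 0) /\ (forall m, (m < n)%N -> qcoord m v = 0)].

(** Otherwise there are arbitrarily many successive blocks [v_k] of norm at most
    one with [f v_k > d].  For [K^2] of them [f] would exceed [K^2 d] at a vector
    of norm at most [3 K]. *)
Lemma dual_small_on_tail_kernel f d : 0 < d ->
  exists n0, forall n, (n0 <= n)%N -> forall v, tail_kernel n v ->
    `|f v| <= d * `|v|.
Proof.
move=> d0; apply: contrapT => /forallNP H.
pose K := (Num.truncn (3 * `|f| / d)).+1.
have Kf : 3 * `|f| / d < K%:R by rewrite truncnS_gt.
have K0 : (0 : R) < K%:R by rewrite ltr0n.
pose eta : R := (4 * K%:R ^+ 2)^-1.
have eta0 : 0 < eta by rewrite invr_gt0 mulr_gt0// exprn_gt0.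
have step r : exists F : JL R * nat,
    almost_block eta r F.2 F.1 /\ d < f F.1.
  have /existsNP[n /not_implyP[rn /existsNP[v /not_implyP[[v0 vq] /negP]]]] := H r.
  rewrite -ltNge => fv.
  have vn0 : 0 < `|v|.
    rewrite normr_gt0; apply/eqP => v00; move: fv.
    by rewrite v00 dual_at0 !normr0 mulr0 ltxx.
  (* the multiple of norm one at which [f] is positive *)
  pose c := Num.sg (f v) / `|v|.
  have cv1 : `|c *: v| <= 1.
    rewrite normrZ normrM normfV normr_id -mulrA mulVf ?gt_eqF// mulr1.
    by rewrite normr_sg; case: (_ != _).
  have [||r0 cvb] := @almost_block_exists _ (c *: v) r eta eta0 cv1.
  - move=> i ir; rewrite -[_ *: v]addr0 JL_coord_linear v0 ?mulr0 ?add0r//.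
    exact: leq_trans ir rn.
  - by move=> m mr; rewrite linearZ/= vq ?mulr0// (leq_trans mr).
  exists (c *: v, r0); split; first exact: cvb.
  rewrite /= dual_atZ /c mulrAC -normrEsg ltr_pdivlMr//.
have {step}[F stepF] := choice step.
pose r k := iter k (fun r => (F r).2) 0%N.
pose v k := (F (r k)).1.
have vN : `|\sum_(k < K ^ 2) v k| <= 3 * K%:R.
  apply: (@almost_blocks_norm _ eta r) => //; first exact: ltW.
    have -> : 4 * (K%:R ^+ 2 * eta) = 1 by rewrite /eta; field; rewrite gt_eqF.
    by [].
  by move=> k; have [] := stepF (r k).
have : K%:R ^+ 2 * d <= `|f| * (3 * K%:R).
  apply: le_trans (ler_wpM2l (normr_ge0 f) vN).
  apply: le_trans (dual_le _ _); apply: le_trans (ler_norm _).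
  rewrite dual_at_sum; apply: (@le_trans _ _ (\sum_(k < K ^ 2) d)).
    by rewrite sumr_const card_ord -[d *+ _]mulr_natl natrX.
  by apply: ler_sum => k _; have [_ /ltW] := stepF (r k).
rewrite mulrA expr2 -mulrA [_ * K%:R]mulrC ler_pM2l// leNgt => /negP; apply.
by rewrite mulrC -ltr_pdivrMr.
Qed.

Definition coordinate_fun (j : bool * nat) : JL R -> R :=
  if j.1 then qcoord j.2 else fun x => x j.2.

Lemma coordinate_subproof j : coordinate_fun j \in @dual_pred R (JL R).
Proof.
have sj : scalar (coordinate_fun j).
  by case: j => [[] m] a x y //; exact: qcoord_scalar.
apply/asboolP; split=> //.
apply: (@scalar_bounded_continuous _ _ _ 1) => // x; rewrite mul1r.
by case: j {sj} => [[] m]; [exact: qcoord_le|exact: JL_coord_le].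
Qed.

Definition coordinate j : dual (JL R) := Dual (coordinate_subproof j).

Lemma dual_sum_at (I : Type) (s : seq I) (F : I -> dual (JL R)) x :
  (\sum_(i <- s) F i) x = \sum_(i <- s) F i x.
Proof. by elim: s => [|i s IH]; rewrite ?big_nil// !big_cons dualD IH. Qed.

(** The canonical projections onto the tails are contractions. *)
Lemma tail_vector x n : exists x', [/\ `|x'| <= `|x|,
  forall i, (i < n)%N -> x' i = 0 &
  x = x' + \sum_(0 <= i < n) x i *: unit_vec i].
Proof.
pose p := \sum_(0 <= i < n) x i *: unit_vec i.
have pE j : p j = (j < n)%N%:R * x j.
  rewrite -(sum_delta x j n) /p; elim: n {p} => [|n IH]; first by rewrite !big_nil.
  by rewrite !big_nat_recr//= -IH [X in _ = _ + X]mulrC eq_sym.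
exists (x - p); split.
- apply: JL_norm_le => s Ks.
  have p0 i : (i < n)%N -> (x - p) i = 0.
    by move=> ni; rewrite -[LHS]/(x i - p i) pE ni mul1r subrr.
  rewrite (pairing_cut n) [X in X + _](@pairing_eq0 _ _ _ n) ?add0r//; last first.
    by rewrite all_map; apply/allP => c _; exact: geq_minr.
  rewrite (_ : pairing _ (x - p) = pairing (cut_below n s) x); last first.
    rewrite /pairing !big_map; apply: eq_bigr => c _; congr (_ * _).
    rewrite /segsum big_nat [RHS]big_nat; apply: eq_bigr => i /andP[ni _].
    rewrite -[(x - p) i]/(x i - p i) pE ltnNge (leq_trans (leq_maxr _ _) ni).
    by rewrite mul0r subr0.
  apply: pairing_le_norm; case: Ks => ss se.
  by split; [exact: successive_cut_below|rewrite energy_cut_below].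
- by move=> i ni; rewrite -[LHS]/(x i - p i) pE ni mul1r subrr.
- by rewrite subrK.
Qed.

(** Fix [n] such that [f] is at most [d] on [tail_kernel n], and [N] so large that
    [f] is at most [d / (n+1)] on [tail_kernel N].  Let [c_m] lift the [m]-th unit
    vector of [c_0] to the tail beyond [N].  For [x] in the tail beyond [n] and in
    the unit ball, let [r] lift the first [n] coordinates of [Q x] to the tail
    beyond [N], and let [p = sum_(m < n) (Q x)_m c_m], of norm at most [n].  Then
    [x - r] and [r - p] lie in these two subspaces, so that [f x] differs from
    [f p = sum_(m < n) (Q x)_m f (c_m)] by at most [2 d + d].  The nonlinear lift
    [r] is needed because its norm is at most 1, a bound that no linear lift
    such as [p] provides.  The coordinates [x_i] with [i < n] take care of the
    part of a vector outside the tail. *)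
Lemma separable_dual_JL : separable (dual (JL R)).
Proof.
apply: (@separable_span _ _ coordinate) => f e e0.
have d0 : 0 < e / 3 by rewrite divr_gt0.
set d := e / 3 in d0.
have [n /(_ n (leqnn n)) fn] := dual_small_on_tail_kernel f d0.
have dn0 : 0 < d / n.+1%:R by rewrite divr_gt0.
have [N0 fN] := dual_small_on_tail_kernel f dn0.
pose N := maxn N0 n; have {}fN := fN N (leq_maxl _ _).
have /choice[c cP] : forall m, exists c : JL R,
    [/\ `|c| <= 1, forall i, (i < N)%N -> c i = 0 &
      forall k, qcoord k c = (k == m)%:R].
  move=> m; have Dm : (fun k => (k == m)%:R) \in @c0_pred R.
    by apply: (@c0_finite _ m.+1) => k mk; rewrite gtn_eqF.
  have [|c [c1 c0 cD]] := @quot_lift _ N (C0 Dm).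
    by apply: c0_norm_le => k /=; rewrite ger0_norm//; case: (_ == _).
  exists c; split=> //; first exact: l1unit_norm.
  by move=> k; rewrite -[LHS]/(quot c k) cD.
pose q := \sum_(m <- iota 0 n) f (c m) *: coordinate (true, m).
pose h := f - q.
have qE x : q x = \sum_(0 <= m < n) f (c m) * qcoord m x.
  by rewrite /q dual_sum_at /index_iota subn0.
have htail x : (forall i, (i < n)%N -> x i = 0) -> `|x| <= 1 -> `|h x| <= e.
  move=> x0 x1.
  have Du : (fun m => if (m < n)%N then qcoord m x else 0) \in @c0_pred R.
    by apply: (@c0_finite _ n) => k mk; rewrite ltnNge mk.
  have [|r [r1 r0 rD]] := @quot_lift _ N (C0 Du).
    apply: c0_norm_le => k /=; case: ifP => _; last by rewrite normr0.
    exact: le_trans (qcoord_le _ _) x1.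
  have {r1} := l1unit_norm r1.
  have rq k : qcoord k r = if (k < n)%N then qcoord k x else 0.
    by rewrite -[LHS]/(quot r k) rD.
  move=> r1.
  pose p := \sum_(0 <= m < n) qcoord m x *: c m.
  have fp : f p = q x.
    rewrite qE /p; elim/big_rec2 : _ => [|m y1 y2 _ <-]; first exact: dual_at0.
    by rewrite dual_atD dual_atZ mulrC.
  have p0 i : (i < N)%N -> p i = 0.
    move=> iN; rewrite /p; elim/big_rec : _ => [//|m y _ y0].
    by rewrite JL_coord_linear y0; case: (cP m) => _ -> //; rewrite mulr0 addr0.
  have pq k : qcoord k p = if (k < n)%N then qcoord k x else 0.
    transitivity (\sum_(0 <= m < n) (m == k)%:R * qcoord m x).
      rewrite /p; elim/big_rec2 : _ => [|m y1 y2 _ <-]; first exact: linear0.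
      by rewrite qcoord_scalar; case: (cP m) => _ _ ->; rewrite mulrC eq_sym.
    by rewrite sum_delta; case: ifP; rewrite ?mul1r ?mul0r.
  have pn : `|p| <= n%:R.
    rewrite (le_trans (ler_norm_sum _ _ _))//.
    apply: (@le_trans _ _ (\sum_(0 <= m < n) 1)).
      apply: ler_sum => m _; rewrite normrZ mulr_ile1//.
        exact: le_trans (qcoord_le _ _) x1.
      by case: (cP m).
    by rewrite sumr_const_nat subn0.
  have xr : `|f (x - r)| <= d * 2.
    rewrite (le_trans (fn _ _))//.
      split=> [i ni|m mn].
        rewrite -[LHS]/(x i - r i) x0// r0 ?subr0//.
        by rewrite (leq_trans ni)// leq_maxr.
      by rewrite linearB/= rq mn subrr.
    by rewrite ler_pM2l// (le_trans (ler_normB _ _))// (_ : 2 = 1 + 1)// lerD.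
  have rp : `|f (r - p)| <= d.
    rewrite (le_trans (fN _ _))//.
      split=> [i iN|m _]; first by rewrite -[LHS]/(r i - p i) r0// p0// subr0.
      by rewrite linearB/= rq pq subrr.
    rewrite mulrAC ler_pdivrMr// ler_pM2l// (le_trans (ler_normB _ _))//.
    by rewrite -natr1 addrC lerD.
  have -> : h x = f (x - r) + f (r - p).
    by rewrite -dual_atD subrKA dualB fp.
  rewrite (le_trans (ler_normD _ _))// (le_trans (lerD xr rp))//.
  by rewrite /d; lra.
pose b := \sum_(i <- iota 0 n) h (unit_vec i) *: coordinate (false, i).
exists ([seq (f (c m), (true, m)) | m <- iota 0 n] ++
        [seq (h (unit_vec i), (false, i)) | i <- iota 0 n]).
rewrite big_cat !big_map/= -/q -/b opprD addrA -/h.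
rewrite dual_normE; apply: sup_norm_le => [|x x1]; first exact: unit_ball_neq0.
have [x' [xx' x'0 xE]] := tail_vector x n.
have -> : (h - b) x = h x'.
  rewrite -[LHS]/(h x - b x) {1}xE dual_atD; apply/eqP.
  rewrite subr_eq; apply/eqP; congr (_ + _).
  rewrite /b dual_sum_at /index_iota subn0.
  elim/big_rec2 : _ => [|i y1 y2 _ <-]; first exact: dual_at0.
  by rewrite dual_atD dual_atZ mulrC.
by apply: htail => //; exact: le_trans xx' x1.
Qed.

End separability.

Theorem theorem5p1 (R : realType) :
  exists (X : completeNormedModType R) (W : set X) (Y : set (dual X)),
    separable (dual X) /\
    [/\ closed W, bounded_set W, convex_set W & symmetric_set W] /\
    closed_subspace Y /\
    thin W /\
    isometric_weak_star_isomorphic (c0 R) Y /\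
    norming (2^-1) W Y.
Proof.
exists (JL R), (@l1unit R), (range (@adjoint R)).
split; first exact: separable_dual_JL.
split.
  split; [exact: closed_l1unit|exact: bounded_l1unit|exact: convex_l1unit|].
  exact: symmetric_l1unit.
split; first exact: closed_subspace_range_adjoint.
split; first exact: thin_l1unit.
split; first exact: adjoint_isomorphism.
exact: l1unit_norming.
Qed.
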